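(* Let $d\in\mathbb{N}$ and let $T$ be a $d$-parameter $C_0$-semigroup over a Hilbert space $\mathcal{H}$ with bounded generators. Then the following statements are equivalent. (1) $T$ has a regular unitary dilation. (2) The generators of $T$ are completely dissipative. (3) There is a net $(T^{(\alpha)})_{\alpha\in\mathcal{I}}$ consisting of $d$-parameter $C_0$-semigroups over $\mathcal{H}$, each having a regular unitary dilation, such that $T^{(\alpha)}\to T$ uniformly in norm on compact subsets of $\mathbb{R}_{\geq 0}^{d}$, i.e. $\sup_{\mathbf{t}\in L}\|T^{(\alpha)}(\mathbf{t})-T(\mathbf{t})\|\underset{\alpha}{\longrightarrow}0$ for all compact $L\subseteq\mathbb{R}_{\geq 0}^{d}$. (4) There is a net $(T^{(\alpha)})_{\alpha\in\mathcal{I}}$ consisting of $d$-parameter $C_0$-semigroups over $\mathcal{H}$, each having a regular unitary dilation, such that $T^{(\alpha)}\to T$ uniformly in the strong operator topology on compact subsets of $\mathbb{R}_{\geq 0}^{d}$, i.e. $\sup_{\mathbf{t}\in L}\|(T^{(\alpha)}(\mathbf{t})-T(\mathbf{t}))\xi\|\underset{\alpha}{\longrightarrow}0$ for all $\xi\in\mathcal{H}$ and all compact $L\subseteq\mathbb{R}_{\geq 0}^{d}$.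
   Context: Hilbert spaces are complex; $\mathfrak{L}(\mathcal{H})$ and $\mathfrak{L}(\mathcal{H},\mathcal{H}')$ denote bounded operators; $\mathbb{N}=\{1,2,\ldots\}$. A $d$-parameter $C_0$-semigroup over $\mathcal{H}$ is a map $T:\mathbb{R}_{\geq 0}^{d}\to\mathfrak{L}(\mathcal{H})$, continuous for the strong operator topology (SOT), with $T(\mathbf{0})=I$ and $T(\mathbf{s}+\mathbf{t})=T(\mathbf{s})T(\mathbf{t})$. Its marginals are the commuting one-parameter $C_0$-semigroups $T_i(t)=T(t\mathbf{e}_i)$, $i\in\{1,\ldots,d\}$ ($\mathbf{e}_i$ the canonical unit vectors), and its generators $A_1,\ldots,A_d$ are the infinitesimal generators of $T_1,\ldots,T_d$ (they commute). For $\mathbf{t}=(t_i)_{i=1}^d\in\mathbb{R}^d$ put $\mathbf{t}^{+}=(\max\{t_i,0\})_i$ and $\mathbf{t}^{-}=(\max\{-t_i,0\})_i$. A regular unitary dilation of $T$ is a tuple $(U,\mathcal{H}',r)$, where $\mathcal{H}'$ is a Hilbert space, $U$ is an SOT-continuous unitary representation of $(\mathbb{R}^d,+,\mathbf{0})$ over $\mathcal{H}'$, and $r\in\mathfrak{L}(\mathcal{H},\mathcal{H}')$ (necessarily isometric), such that $T(\mathbf{t}^{-})^{*}T(\mathbf{t}^{+})=r^{*}U(\mathbf{t})r$ for all $\mathbf{t}\in\mathbb{R}^d$. For $K\subseteq\{1,\ldots,d\}$ the dissipation operator is $$S_{T,K}=2^{-|K|}\sum_{(C_1,C_2)}\Big(\prod_{i\in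 C_1}(-A_i)\Big)^{*}\Big(\prod_{i\in C_2}(-A_i)\Big),$$ the sum running over all ordered pairs $(C_1,C_2)$ of disjoint, possibly empty sets with $C_1\cup C_2=K$ (empty products are $I$). The generators of $T$ are completely dissipative if $S_{T,K}\geq 0$ (positive semi-definite) for every $K\subseteq\{1,\ldots,d\}$. *)

(* Defs.v *)
From HB Require Import structures.
From mathcomp Require Import all_boot all_order all_algebra.
From mathcomp Require Import sesquilinear complex.
From mathcomp Require Import all_classical all_reals all_analysis.

Set Implicit Arguments.
Unset Strict Implicit.
Unset Printing Implicit Defensive.

Import Order.TTheory GRing.Theory Num.Theory.
Import numFieldNormedType.Exports.

Local Open Scope classical_set_scope.
Local Open Scope ring_scope.

(* The inner product is linear in its first argument and conjugate-linear in
   the second one.  In a normed module over R[i] the norm is R[i]-valued. *)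
HB.mixin Record isHilbert (R : realType) V & CompleteNormedModule R[i] V := {
  inner : {dot V for @Num.conj R[i]} ;
  inner_norm : forall x : V, `|x| ^+ 2 = inner x x
}.

#[short(type="hilbertType")]
HB.structure Definition Hilbert (R : realType) :=
  { V of isHilbert R V & CompleteNormedModule R[i] V }.

Section operators.
Context {R : realType} {H H' : hilbertType R}.
Implicit Types A : H -> H'.

Definition rnorm (x : H) : R := complex.Re `|x|.

Definition bounded_operator A : Prop :=
  linear A /\ exists M : R, forall x, `|A x| <= (M%:C)%C * `|x|.

(* For a bounded operator the set below is a singleton, by the Riesz
   representation theorem; the default 0 is then never used. *)
Definition adjoint A : H' -> H :=
  fun y => xget 0 [set x | forall z, inner z x = inner (A z) y].

End operators.

Definition opnorm {R : realType} {H H' : hilbertType R} (A : H -> H')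
    : \bar R :=
  ereal_sup [set (rnorm (A x))%:E | x in [set x | rnorm x <= 1]].

Definition unitary_operator {R : realType} {H : hilbertType R} (A : H -> H)
    : Prop :=
  [/\ bounded_operator A, adjoint A \o A =1 id & A \o adjoint A =1 id].

Definition positive_operator {R : realType} {H : hilbertType R} (A : H -> H)
    : Prop :=
  forall x, 0 <= inner (A x) x.

Definition orthant (R : realType) (d : nat) : set 'rV[R]_d :=
  [set t | forall i, 0 <= t 0 i].

(* A map on the orthant is represented by a total function on 'rV_d whose
   values outside of the orthant are irrelevant. *)
Record C0_semigroup {R : realType} {d : nat} {H : hilbertType R}
    (T : 'rV[R]_d -> H -> H) : Prop := {
  C0_bounded : forall t, orthant t -> bounded_operator (T t) ;
  C0_id : T 0 =1 id ;
  C0_add : forall s t, orthant s -> orthant t -> T (s + t) =1 T s \o T t ;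
  C0_continuous :
    forall x, {within @orthant R d, continuous (fun t => T t x)}
}.

Section dilation.
Context {R : realType} {d : nat}.
Implicit Types t : 'rV[R]_d.

Definition pos_part t : 'rV[R]_d := \row_i Num.max (t 0 i) 0.
Definition neg_part t : 'rV[R]_d := \row_i Num.max (- t 0 i) 0.

Record unitary_representation {H : hilbertType R} (U : 'rV[R]_d -> H -> H)
    : Prop := {
  urep_unitary : forall t, unitary_operator (U t) ;
  urep_id : U 0 =1 id ;
  urep_add : forall s t, U (s + t) =1 U s \o U t ;
  urep_continuous : forall x, continuous (fun t => U t x)
}.

Definition regular_unitary_dilation {H H' : hilbertType R}
    (T : 'rV[R]_d -> H -> H) (U : 'rV[R]_d -> H' -> H') (r : H -> H') : Prop :=
  [/\ unitary_representation U, bounded_operator r &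
      forall t, adjoint (T (neg_part t)) \o T (pos_part t)
                =1 adjoint r \o U t \o r].

Definition has_regular_unitary_dilation {H : hilbertType R}
    (T : 'rV[R]_d -> H -> H) : Prop :=
  exists (H' : hilbertType R) (U : 'rV[R]_d -> H' -> H') (r : H -> H'),
    regular_unitary_dilation T U r.

End dilation.

Section generator.
Context {R : realType} {H : hilbertType R}.
Implicit Types S : R -> H -> H.

Definition difference_quotient S (x : H) (t : R) : H :=
  ((t^-1)%:C)%C *: (S t x - x).

Definition generator_domain S : set H :=
  [set x | cvg (difference_quotient S x t @[t --> 0^'+])].

Definition generator S (x : H) : H :=
  lim (difference_quotient S x t @[t --> 0^'+]).

Definition has_bounded_generator S : Prop :=
  generator_domain S = setT /\ bounded_operator (generator S).

End generator.

Section dissipation.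
Context {R : realType} {d : nat} {H : hilbertType R}.
Implicit Types (T : 'rV[R]_d -> H -> H) (C K : {set 'I_d}).

Definition marginal T (i : 'I_d) : R -> H -> H :=
  fun t => T (t *: delta_mx 0 i).

Definition has_bounded_generators T : Prop :=
  forall i, has_bounded_generator (marginal T i).

(* Composition in increasing order of the indices; the factors commute. *)
Definition neg_generator_prod T C : H -> H :=
  \big[comp/idfun]_(i in C) (fun x => - generator (marginal T i) x).

Definition dissipation_operator T K : H -> H := fun x =>
  2 ^- #|K| *:
  \sum_(C : {set 'I_d} * {set 'I_d} |
          [disjoint C.1 & C.2] && (C.1 :|: C.2 == K)%SET)
     adjoint (neg_generator_prod T C.1) (neg_generator_prod T C.2 x).

Definition completely_dissipative T : Prop :=
  forall K, positive_operator (dissipation_operator T K).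

End dissipation.

Definition directed {I : Type} (le : I -> I -> Prop) : Prop :=
  [/\ inhabited I,
      forall a, le a a,
      forall a b c, le a b -> le b c -> le a c &
      forall a b, exists c, le a c /\ le b c].

Definition net_tails {I : Type} (le : I -> I -> Prop) : set_system I :=
  filter_from setT (fun a => [set b | le a b]).

(* Supremum over L of nonnegative quantities, equal to 0 if L is empty. *)
Definition sup_on {R : realType} {E : Type} (L : set E) (f : E -> \bar R)
    : \bar R :=
  ereal_sup ([set 0%E] `|` [set f t | t in L]).

(* Main.v *)
Require Import Defs.
From HB Require Import structures.
From mathcomp Require Import all_boot all_order all_algebra.
From mathcomp Require Import sesquilinear complex.
From mathcomp Require Import all_classical all_reals all_analysis.
From mathcomp Require Import ring lra.

Set Implicit Arguments.
Unset Strict Implicit.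
Unset Printing Implicit Defensive.

Import Order.TTheory GRing.Theory Num.Theory.
Import numFieldNormedType.Exports.

Local Open Scope classical_set_scope.
Local Open Scope ring_scope.

Local Notation Re := complex.Re.
Local Notation Im := complex.Im.

(** The values of T enter a regular dilation only through the operator function
    phi sending t to the adjoint of T(t^-) composed with T(t^+), and a regular
    unitary dilation exists exactly when phi is positive definite: the sum over
    j, k of <phi(t_j - t_k) x_j, x_k> is nonnegative for all finite families of
    points t_j of R^d and vectors x_j.  All four statements are compared with
    this condition, [positive_definite].

    - Given a dilation, the sum above is the squared norm of the sum of the
      U(t_j) r x_j ([dilation_positive_definite]).  Conversely a positive
      definite phi defines a scalar positive kernel on R^d x H; the functions
      of its reproducing kernel Hilbert space are translated unitarily by R^d,
      and this is the dilation ([positive_definite_dilation]).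

    - For a form B put (lyap A B)(u, v) = - B(A u, v) - B(u, A v).  Up to the
      factor 2^-|K|, the dissipation operator of K is the form obtained from
      the inner product by applying lyap for all generators A_i, i in K
      ([inner_dissipation_operator]).  Positivity of lyap A_i B says that
      B(T_i(s) u, T_i(s) u) decreases in s ([lyap_ge0_deficit_ge0]), and the
      operations B |-> lyap A_j B and B |-> B - B(T_i(c) ., T_i(c) .) commute.
      So, if the generators are completely dissipative, the difference form
      B - B(T_i(c) ., T_i(c) .) is again dissipative for the coordinates other
      than i.  Positive definiteness follows by collapsing the points t_j, one
      coordinate i after the other: pushing the points with the largest i-th
      coordinate down to the next value, at distance c, changes the sum by a
      sum of the same kind for that difference form and one coordinate less
      ([regular_sum_ge0]).

    - Given a dilation, replace each generator by an increment T_i(h) - I.  The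
      iterated form at (x, x) then is the squared norm of the vector obtained
      from r x by applying I - U(h e_i) for all i in K
      ([lyap_increments_dilation]); dividing by the steps and letting them
      tend to 0 yields complete dissipativity
      ([dilation_completely_dissipative]).

    - Positive definiteness only involves finitely many values of T, so it
      passes to pointwise strong limits ([cvg_positive_definite]).  This gives
      the implication from the strong approximation to the dilation; constant
      nets and the comparison of the two modes of convergence do the rest. *)

(** * Complex numbers, inner products and linear maps *)

Section complex_facts.
Context {R : realType}.
Implicit Types z w : R[i].

Lemma ReD z w : Re (z + w) = Re z + Re w.
Proof. by case: z; case: w. Qed.
Lemma ReN z : Re (- z) = - Re z.
Proof. by case: z. Qed.
Lemma ReB z w : Re (z - w) = Re z - Re w.
Proof. by rewrite ReD ReN. Qed.
Lemma Re_conjc z : Re (Num.conj z) = Re z.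
Proof. by case: z. Qed.
Lemma Re_sum I (s : seq I) (P : pred I) (F : I -> R[i]) :
  Re (\sum_(i <- s | P i) F i) = \sum_(i <- s | P i) Re (F i).
Proof. exact: (big_morph _ ReD). Qed.
Lemma ReZ (a : R) z : Re (a%:C%C * z) = a * Re z.
Proof. by case: z => x y; rewrite /= mul0r subr0. Qed.
Lemma ler_Re_norm z : (Re z)%:C%C <= `|z|.
Proof.
rewrite normc_def lecR; apply: le_trans (ler_norm _) _.
by rewrite -sqrtr_sqr ler_wsqrtr // lerDl sqr_ge0.
Qed.
Lemma normr_Re_le z : `|Re z|%:C%C <= `|z|.
Proof. by rewrite normc_def lecR -sqrtr_sqr ler_wsqrtr // lerDl sqr_ge0. Qed.
Lemma ge0_RRe z : 0 <= z -> (Re z)%:C%C = z.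
Proof. by move=> /ger0_real/RRe_real. Qed.
End complex_facts.

Section hilbert.
Context {R : realType} {H : hilbertType R}.
Implicit Types x y z : H.

Lemma inner_conj x y : inner x y = Num.conj (inner y x).
Proof. by rewrite hermC /= expr0 mul1r. Qed.
Lemma innerDl x y z : inner (x + y) z = inner x z + inner y z.
Proof. by rewrite linearDl. Qed.
Lemma innerZl a x z : inner (a *: x) z = a * inner x z.
Proof. by rewrite linearZl_LR. Qed.
Lemma innerDr x y z : inner z (x + y) = inner z x + inner z y.
Proof. by rewrite linearDr. Qed.
Lemma innerZr a x z : inner z (a *: x) = Num.conj a * inner z x.
Proof. by rewrite linearZr_LR. Qed.
Lemma innerNl x z : inner (- x) z = - inner x z. Proof. by rewrite linearNl. Qed.
Lemma innerNr x z : inner z (- x) = - inner z x. Proof. by rewrite linearNr. Qed.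

Lemma rnormE x : `|x| = (rnorm x)%:C%C.
Proof. by rewrite /rnorm ge0_RRe. Qed.
Lemma rnorm_ge0 x : 0 <= rnorm x.
Proof. by rewrite -ler0c -rnormE. Qed.
Lemma inner_rnorm x : inner x x = (rnorm x ^+ 2)%:C%C.
Proof. by rewrite -inner_norm rnormE rmorphXn. Qed.
Lemma Re_inner_self x : Re (inner x x) = rnorm x ^+ 2.
Proof. by rewrite inner_rnorm. Qed.

Lemma Re_innerC x y : Re (inner x y) = Re (inner y x).
Proof. by rewrite inner_conj Re_conjc. Qed.

Lemma inner_ext x y : (forall z, inner z x = inner z y) -> x = y.
Proof.
move=> h; apply/eqP; rewrite -subr_eq0 -normr_eq0 -sqrf_eq0 inner_norm.
by rewrite innerDr innerNr h subrr.
Qed.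

Lemma rnormD_sqr x y :
  rnorm (x + y) ^+ 2 = rnorm x ^+ 2 + rnorm y ^+ 2 + 2 * Re (inner x y).
Proof.
rewrite -!Re_inner_self innerDl !innerDr !ReD (Re_innerC y x); ring.
Qed.

Lemma rnormN x : rnorm (- x) = rnorm x.
Proof. by rewrite /rnorm normrN. Qed.

Lemma rnormZ a x : rnorm (a *: x) = Re `|a| * rnorm x.
Proof. by rewrite /rnorm normrZ rnormE -[`|a|]ge0_RRe // ReZ. Qed.

(** Expand the squared norm of the difference of x and its projection to y. *)
Lemma cauchy_schwarz x y : `|inner x y| <= `|x| * `|y|.
Proof.
have [->|y0] := eqVneq y 0.
  by rewrite linear0r !normr0 mulr0.
have yy0 : `|y| ^+ 2 != 0 by rewrite expf_neq0 // normr_eq0.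
have yr : Num.conj (`|y| ^+ 2) = `|y| ^+ 2.
  by apply/CrealP; rewrite realX // normr_real.
have [c [cE cJ]] : exists c, c = inner x y / `|y| ^+ 2 /\
    Num.conj c = Num.conj (inner x y) / `|y| ^+ 2.
  exists (inner x y / `|y| ^+ 2); split=> //.
  by rewrite -[in RHS]yr -fmorphV -rmorphM.
have : 0 <= `|x - c *: y| ^+ 2 by rewrite exprn_ge0.
have -> : `|x - c *: y| ^+ 2 = `|x| ^+ 2 - `|inner x y| ^+ 2 / `|y| ^+ 2.
  rewrite !inner_norm innerDl !innerDr !innerNl !innerNr !innerZl !innerZr.
  rewrite -!inner_norm (inner_conj y x) normCK cJ cE.
  move: yy0; move: (`|y| ^+ 2) (`|x| ^+ 2) (inner x y) (Num.conj _).
  by move=> n m a b n0; field.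
rewrite subr_ge0 ler_pdivrMr; last by rewrite exprn_gt0 // normr_gt0.
by rewrite -exprMn ler_pXn2r // nnegrE mulr_ge0.
Qed.

(** The norm of a Hilbert space takes values in R[i]; real-valued distances give
    access to the limit lemmas for totally ordered fields. *)
Lemma cvg_dist0 (T : Type) (F : set_system T) (FF : Filter F) (f : T -> H) x :
  f @ F --> x <-> (fun t => rnorm (f t - x)) @ F --> (0 : R).
Proof.
split=> [/cvgrPdist_lt h|/cvgrPdist_lt h]; apply/cvgrPdist_lt => e e0.
  have /h : 0 < e%:C%C by rewrite ltcR.
  apply: filterS => t.
  by rewrite distrC rnormE ltcR sub0r normrN ger0_norm ?rnorm_ge0.
have re0 : 0 < Re e by move: e0; rewrite ltcE => /andP[].
rewrite -(ge0_RRe (ltW e0)); apply: filterS (h _ re0) => t.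
by rewrite sub0r normrN ger0_norm ?rnorm_ge0 // distrC rnormE ltcR.
Qed.

Lemma rnorm_triangle x y : rnorm (x + y) <= rnorm x + rnorm y.
Proof. by rewrite -lecR rmorphD /= -!rnormE ler_normD. Qed.

Lemma cvg_rnorm (T : Type) (F : set_system T) (FF : Filter F) (f : T -> H) x :
  f @ F --> x -> (fun t => rnorm (f t)) @ F --> rnorm x.
Proof.
move=> /cvg_dist0/cvgrPdist_le h; apply/cvgrPdist_le => e e0.
apply: filterS (h e e0) => t; rewrite sub0r normrN; apply: le_trans.
rewrite [leRHS]ger0_norm ?rnorm_ge0 // ler_norml.
have := rnorm_triangle (f t - x) x; have := rnorm_triangle (x - f t) (f t).
by rewrite !subrK -[rnorm (x - f t)]rnormN opprB => h1 h2; apply/andP; split; lra.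
Qed.
End hilbert.

Section linear_maps.
Context {K : pzRingType} {U V : lmodType K} (f : U -> V) (fl : linear f).
Lemma linD x y : f (x + y) = f x + f y.
Proof. by rewrite -[x in LHS]scale1r fl scale1r. Qed.
Lemma lin0 : f 0 = 0.
Proof. by apply: (addIr (f 0)); rewrite -linD !add0r. Qed.
Lemma linZ a x : f (a *: x) = a *: f x.
Proof. by rewrite -[a *: x in LHS]addr0 fl lin0 addr0. Qed.
Lemma linN x : f (- x) = - f x.
Proof. by rewrite -scaleN1r linZ scaleN1r. Qed.
Lemma linB x y : f (x - y) = f x - f y.
Proof. by rewrite linD linN. Qed.
End linear_maps.

(** * Bounded Hermitian forms *)

(** The dissipativity argument works with forms instead of operators, so that no
    adjoint has to be formed. *)
Record hermitian_form {R : realType} {H : hilbertType R} (B : H -> H -> R[i])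
    : Prop := {
  form_lin : forall v a x y, B (a *: x + y) v = a * B x v + B y v ;
  form_conj : forall u v, B v u = Num.conj (B u v) ;
  form_bound : exists2 M : R, 0 <= M &
    forall u v, `|B u v| <= M%:C%C * `|u| * `|v|
}.

Section forms.
Context {R : realType} {H : hilbertType R} (B : H -> H -> R[i]).
Hypothesis hB : hermitian_form B.

Lemma formDl u v w : B (u + v) w = B u w + B v w.
Proof. by have := form_lin hB w 1 u v; rewrite scale1r mul1r. Qed.
Lemma form0l w : B 0 w = 0.
Proof. by apply: (addIr (B 0 w)); rewrite -formDl !add0r. Qed.
Lemma formZl a u w : B (a *: u) w = a * B u w.
Proof. by rewrite -[a *: u]addr0 form_lin // form0l addr0. Qed.
Lemma formNl u w : B (- u) w = - B u w.
Proof. by rewrite -scaleN1r formZl mulN1r. Qed.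
Lemma formBl u v w : B (u - v) w = B u w - B v w.
Proof. by rewrite formDl formNl. Qed.
Lemma formDr u v w : B w (u + v) = B w u + B w v.
Proof. by rewrite !(form_conj hB _ w) formDl rmorphD. Qed.
Lemma formZr a u w : B w (a *: u) = Num.conj a * B w u.
Proof. by rewrite !(form_conj hB _ w) formZl rmorphM. Qed.
Lemma formNr u w : B w (- u) = - B w u.
Proof. by rewrite !(form_conj hB _ w) formNl rmorphN. Qed.
Lemma formBr u v w : B w (u - v) = B w u - B w v.
Proof. by rewrite formDr formNr. Qed.
Lemma form0r w : B w 0 = 0.
Proof. by rewrite (form_conj hB) form0l rmorph0. Qed.
Lemma form_suml I (s : seq I) (P : pred I) (f : I -> H) w :
  B (\sum_(i <- s | P i) f i) w = \sum_(i <- s | P i) B (f i) w.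
Proof. by apply: (big_morph (B^~ w)) => [x y|]; rewrite ?formDl ?form0l. Qed.
Lemma form_sumr I (s : seq I) (P : pred I) (f : I -> H) w :
  B w (\sum_(i <- s | P i) f i) = \sum_(i <- s | P i) B w (f i).
Proof. by apply: (big_morph (B w)) => [x y|]; rewrite ?formDr ?form0r. Qed.

Lemma form_real u : (Re (B u u))%:C%C = B u u.
Proof.
have := form_conj hB u u; case: (B u u) => a b /= [] /eqP.
by rewrite -addr_eq0 -mulr2n mulrn_eq0 /= => /eqP ->.
Qed.

(** Boundedness makes a form jointly continuous, so the two arguments may
    converge at the same time. *)
Lemma cvg_Re_form (T : Type) (F : set_system T) (FF : Filter F)
    (f g : T -> H) u v :
  f @ F --> u -> g @ F --> v ->
  (fun t => Re (B (f t) (g t))) @ F --> Re (B u v).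
Proof.
move=> fu gv; have [M M0 hM] := form_bound hB.
have split t : B (f t) (g t) - B u v = B (f t - u) (g t) + B u (g t - v).
  by rewrite formBl formBr; ring.
have ReM x y : `|Re (B x y)| <= M * rnorm x * rnorm y.
  rewrite -lecR !rmorphM /= -!rnormE; apply: le_trans (hM x y).
  exact: normr_Re_le.
have lim0 : (fun t => M * rnorm (f t - u) * rnorm (g t)
    + M * rnorm u * rnorm (g t - v)) @ F --> (0 : R).
  rewrite [X in _ --> X](_ : _ = M * 0 * rnorm v + M * rnorm u * 0); last first.
    by rewrite !(mulr0, mul0r) addr0.
  apply: cvgD; apply: cvgM.
  - by apply: cvgM; [exact: cvg_cst|exact/cvg_dist0].
  - exact: cvg_rnorm.
  - exact: cvg_cst.
  - exact/cvg_dist0.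
apply/cvgrPdist_le => e e0.
move/cvgrPdist_le: lim0 => /(_ e e0).
apply: filterS => t; rewrite sub0r normrN => ht.
rewrite distrC -ReB split ReD; apply: le_trans ht.
apply: le_trans (ler_norm _); apply: le_trans (ler_normD _ _) _.
by apply: lerD; apply: ReM.
Qed.
End forms.

Section inner_form.
Context {R : realType} {H : hilbertType R}.

Lemma inner_hermitian : hermitian_form (@inner R H).
Proof.
split=> [v a x y|u v|]; first by rewrite innerDl innerZl.
  exact: inner_conj.
by exists 1 => // u v; rewrite mul1r; exact: cauchy_schwarz.
Qed.
End inner_form.

(** * The Riesz representation theorem and adjoints *)

Section riesz.
Context {R : realType} {H : hilbertType R} (f : H -> R[i]).
Hypothesis f_lin : forall a x y, f (a *: x + y) = a * f x + f y.
Hypothesis f_bound : exists M : R, forall x, `|f x| <= M%:C%C * `|x|.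

(** If f is represented by y, this is the squared distance of x to y, up to a
    constant; y is found as the minimizer. *)
Let energy (x : H) : R := rnorm x ^+ 2 - 2 * Re (f x).

Let M := xget 0 [set M : R | 0 <= M /\ forall x, `|f x| <= M%:C%C * `|x|].

Let fM : 0 <= M /\ forall x, `|f x| <= M%:C%C * `|x|.
Proof.
rewrite /M; case: xgetP => [_ _ //|]; have [N hN] := f_bound.
move/(_ (Num.max 0 N)); case; split; first by rewrite le_max lexx.
move=> x; apply: le_trans (hN x) _.
by rewrite ler_wpM2r // lecR le_max lexx orbT.
Qed.

Let Ref_le x : Re (f x) <= M * rnorm x.
Proof.
have [_ /(_ x) h] := fM; rewrite -lecR rmorphM /= -rnormE.
exact: le_trans (ler_Re_norm _) h.
Qed.

Let fD x y : f (x + y) = f x + f y.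
Proof. by rewrite -[x in LHS]scale1r f_lin mul1r. Qed.

Let f0 : f 0 = 0.
Proof. by apply: (addIr (f 0)); rewrite -fD !add0r. Qed.

Let fZ a x : f (a *: x) = a * f x.
Proof. by rewrite -[a *: x in LHS]addr0 f_lin f0 addr0. Qed.

Let energy_ge x : - M ^+ 2 <= energy x.
Proof.
rewrite /energy; have := Ref_le x; have := sqr_ge0 (rnorm x - M).
by rewrite sqrrB -mulr_natl; lra.
Qed.

Let m := inf (range energy).

Let m_le x : m <= energy x.
Proof.
by apply: ge_inf; [exists (- M ^+ 2) => _ [z _ <-]|exists x].
Qed.

Let energy_step x z (s : R) : energy (x + s%:C%C *: z) =
  energy x + s ^+ 2 * rnorm z ^+ 2 + 2 * s * (Re (inner z x) - Re (f z)).
Proof.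
rewrite /energy rnormD_sqr fD fZ ReD ReZ Re_innerC innerZl ReZ rnormZ exprMn.
have -> : Re `|s%:C%C| ^+ 2 = s ^+ 2.
  by rewrite normc_def /= expr0n /= addr0 sqr_sqrtr // sqr_ge0.
ring.
Qed.

(** The midpoint of x and y has energy at least m, which bounds their distance
    by the parallelogram identity. *)
Let energy_near x y e :
  energy x <= m + e -> energy y <= m + e -> rnorm (x - y) ^+ 2 <= 4 * e.
Proof.
move=> hx hy; have := m_le (x + (2^-1)%:C%C *: (y - x)).
have := energy_step x (y - x) 1; rewrite scale1r addrC subrK => h1.
rewrite energy_step -[rnorm (y - x)]rnormN opprB in h1 *.
move: h1 hx hy; move: (energy x) (energy y) (rnorm _) (Re _ - Re _).
by move=> a b c d; lra.
Qed.

(** The minimizing filter is Cauchy by [energy_near]; at its limit y the energy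
    is minimal in every direction, so its first variation vanishes there. *)
Lemma riesz : exists y, forall x, f x = inner x y.
Proof.
pose F := filter_from [set e : R | 0 < e] (fun e => [set x | energy x < m + e]).
have FP : ProperFilter F.
  apply: filter_from_proper.
    apply: filter_from_filter; first by exists 1 => /=.
    move=> e1 e2 /= e10 e20; exists (Num.min e1 e2) => /=.
      by rewrite lt_min e10.
    by move=> x /= h; split; apply: lt_le_trans h _; rewrite lerD2l ge_min lexx
      ?orbT.
  move=> e /= e0.
  have [|_ [x _ <-] hx] := @inf_adherent _ (range energy) e e0; last by exists x.
  by split; [exists (energy 0), 0|exists (- M ^+ 2) => _ [z _ <-]].
have /(cauchy_cvg F)/cvg_ex [y Fy] : cauchy F.
  apply/cauchyP => e e0; have re0 : 0 < Re e by move: e0; rewrite ltcE => /andP[].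
  have eE : e = (Re e)%:C%C by rewrite ge0_RRe // ltW.
  have d0 : 0 < Re e ^+ 2 / 5 by rewrite divr_gt0 // exprn_gt0.
  have [x hx] : [set x | energy x < m + Re e ^+ 2 / 5] !=set0.
    by apply: (filter_ex (F := F)); exists (Re e ^+ 2 / 5).
  exists x; exists (Re e ^+ 2 / 5) => // y hy; rewrite -ball_normE /=.
  rewrite eE rnormE ltcR -(@ltr_pXn2r _ 2) ?nnegrE ?rnorm_ge0 ?(ltW re0) //.
  by have := energy_near (ltW hx) (ltW hy); move: d0; lra.
have /cvg_dist0/cvgrPdist_lt yF : id @ F --> y by [].
(* The energy may only grow along the line from y in direction z. *)
have quad z s : 0 <= s ^+ 2 * rnorm z ^+ 2
    + 2 * s * (Re (inner z y) - Re (f z)).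
  apply/ler_addgt0Pr => e e0.
  pose c := 1 + 2 * `|s| * rnorm z.
  have c0 : 0 < c.
    by rewrite ltr_pwDl // mulr_ge0 ?rnorm_ge0 // mulr_ge0.
  have ec0 : 0 < e / c by rewrite divr_gt0.
  have [x [xE xy]] : ([set x | energy x < m + e / c] `&`
      [set x | `|0 - rnorm (x - y)| < e / c]) !=set0.
    by apply: (filter_ex (F := F)); apply: filterI; [exists (e / c)|exact: yF].
  have := m_le (x + s%:C%C *: z); rewrite energy_step => hs.
  have xyz : `|s * Re (inner z (x - y))| <= `|s| * (rnorm z * (e / c)).
    rewrite normrM ler_wpM2l // -lecR; apply: le_trans (normr_Re_le _) _.
    apply: le_trans (cauchy_schwarz _ _) _; rewrite rmorphM /= rnormE.
    rewrite ler_wpM2l // ?ler0c ?rnorm_ge0 // rnormE lecR.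
    by move: xy; rewrite /= sub0r normrN ger0_norm ?rnorm_ge0 // => /ltW.
  have ecE : e / c + 2 * (`|s| * (rnorm z * (e / c))) = e.
    by rewrite -[RHS](divfK (lt0r_neq0 c0)); move: (e / c) => q; rewrite /c; ring.
  move: xyz xE hs => /=; rewrite innerDr innerNr ReB ler_norml.
  by have := ecE => h0 /andP[h1 h2] h3 h4; lra.
have ReE z : Re (f z) = Re (inner z y).
  (* The step is close to the minimizer of the quadratic in s; adding 1 to the
     denominator avoids the case z = 0. *)
  have := quad z (- (Re (inner z y) - Re (f z)) / (rnorm z ^+ 2 + 1)).
  set D := Re (inner z y) - Re (f z); set N := rnorm z ^+ 2.
  have N0 : 0 <= N by rewrite exprn_ge0 // rnorm_ge0.
  have n0 : N + 1 != 0 by rewrite gt_eqF // ltr_wpDl.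
  have -> : (- D / (N + 1)) ^+ 2 * N + 2 * (- D / (N + 1)) * D =
      - (D ^+ 2 * ((N + 2) / (N + 1) ^+ 2)) by field.
  rewrite oppr_ge0 pmulr_lle0; last first.
    by rewrite divr_gt0 // ?exprn_gt0 ?ltr_wpDl.
  by rewrite real_exprn_even_le0 ?num_real //= subr_eq0 => /eqP.
(* The imaginary part of f z is minus the real part of f (i z). *)
exists y => z; have := ReE ((0 +i* 1)%C *: z).
rewrite fZ innerZl; have := ReE z.
case: (f z) (inner z y) => [a b] [a' b'] /= ->.
by rewrite !mul0r !mul1r !sub0r => /oppr_inj ->.
Qed.
End riesz.

Section adjoint.
Context {R : realType} {H H' : hilbertType R} (A : H -> H').
Hypothesis hA : bounded_operator A.

Lemma innerA z y : inner z (adjoint A y) = inner (A z) y.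
Proof.
suff [x hx] : exists x, forall z, inner z x = inner (A z) y.
  by rewrite /adjoint; case: xgetP => [a _ ->//|/(_ x)]; case.
case: hA => Al [M hM].
have [x hx] : exists x, forall z, inner (A z) y = inner z x.
  apply: riesz => [a u v|].
    by rewrite Al innerDl innerZl.
  exists (M * rnorm y) => u; apply: le_trans (cauchy_schwarz _ _) _.
  by rewrite rmorphM /= -rnormE mulrAC ler_wpM2r.
by exists x.
Qed.

Lemma adjointE y x : (forall z, inner z x = inner (A z) y) -> adjoint A y = x.
Proof. by move=> h; apply: inner_ext => z; rewrite innerA h. Qed.
End adjoint.

(** * Positive kernels and the energy of a function *)

(** The list e stands for the formal combination of kernel sections with
    coefficients p.1 at the points p.2; lists spare the construction of a free
    vector space, since repetitions in e are harmless. *)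
Record pd_kernel (R : realType) (Y : Type) := PDKernel {
  kernel :> Y -> Y -> R[i] ;
  kernel_conj : forall y z, kernel z y = Num.conj (kernel y z) ;
  kernel_psd : forall e : seq (R[i] * Y),
    0 <= Re (\sum_(p <- e) Num.conj p.1 * \sum_(q <- e) q.1 * kernel p.2 q.2)
}.

Section kernel_combinations.
Context {R : realType} {Y : Type} (k : pd_kernel R Y).
Implicit Types (f g : Y -> R[i]^o) (e : seq (R[i] * Y)).

(** The inner product of f with the combination e, by the reproducing
    property. *)
Definition pairing f e : R[i] := \sum_(p <- e) Num.conj p.1 * f p.2.
Definition ker_comb e : Y -> R[i]^o := fun y => \sum_(p <- e) p.1 * k y p.2.
Definition comb_sqr e : R := Re (pairing (ker_comb e) e).
Definition scale_comb (c : R[i]) e := [seq (c * p.1, p.2) | p <- e].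
(** This is what is gained by e in approximating f: the squared norm of f minus
    the squared distance of f to the combination e. *)
Definition gap f e : R := 2 * Re (pairing f e) - comb_sqr e.

Lemma comb_sqr_ge0 e : 0 <= comb_sqr e.
Proof. exact: kernel_psd. Qed.

Lemma pairingD f g e : pairing (f + g) e = pairing f e + pairing g e.
Proof. by rewrite -big_split /=; apply: eq_bigr => p _; rewrite mulrDr. Qed.
Lemma pairingZ c f e : pairing (c *: f) e = c * pairing f e.
Proof. by rewrite mulr_sumr; apply: eq_bigr => p _; rewrite mulrCA. Qed.
Lemma pairing_cat f e1 e2 : pairing f (e1 ++ e2) = pairing f e1 + pairing f e2.
Proof. exact: big_cat. Qed.
Lemma pairing_scale f c e : pairing f (scale_comb c e) = Num.conj c * pairing f e.
Proof.
rewrite /pairing big_map mulr_sumr; apply: eq_bigr => p _ /=.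
by rewrite rmorphM mulrA.
Qed.
Lemma ker_comb_cat e1 e2 : ker_comb (e1 ++ e2) = ker_comb e1 + ker_comb e2.
Proof. by apply/funext => y; exact: big_cat. Qed.
Lemma ker_comb_scale c e : ker_comb (scale_comb c e) = c *: ker_comb e.
Proof.
apply/funext => y; rewrite /ker_comb big_map -[RHS]/(c * \sum_(p <- e) p.1 * k y p.2).
by rewrite mulr_sumr; apply: eq_bigr => p _; rewrite mulrA.
Qed.

Lemma pairing_conj e1 e2 :
  pairing (ker_comb e1) e2 = Num.conj (pairing (ker_comb e2) e1).
Proof.
rewrite /pairing /ker_comb rmorph_sum /=.
under eq_bigr do rewrite mulr_sumr.
rewrite exchange_big /=; apply: eq_bigr => p _.
rewrite rmorphM /= rmorph_sum mulr_sumr conjCK; apply: eq_bigr => q _.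
by rewrite rmorphM /= -kernel_conj; ring.
Qed.

Lemma comb_sqr_cat e1 e2 : comb_sqr (e1 ++ e2) =
  comb_sqr e1 + comb_sqr e2 + 2 * Re (pairing (ker_comb e1) e2).
Proof.
rewrite /comb_sqr ker_comb_cat pairingD !pairing_cat !ReD.
by rewrite (pairing_conj e2 e1) Re_conjc; ring.
Qed.

Lemma Re_mul_conj (c z : R[i]) :
  Re (c * (Num.conj c * z)) = Re `|c| ^+ 2 * Re z.
Proof.
rewrite mulrA -normCK -[`|c|]ge0_RRe // -rmorphXn.
by rewrite ReZ.
Qed.

Lemma comb_sqr_scale c e : comb_sqr (scale_comb c e) = Re `|c| ^+ 2 * comb_sqr e.
Proof. by rewrite /comb_sqr ker_comb_scale pairingZ pairing_scale Re_mul_conj. Qed.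

Lemma gap_nil f : gap f [::] = 0.
Proof. by rewrite /gap /comb_sqr /pairing !big_nil /= mulr0 subr0. Qed.

Definition finite_energy : {pred Y -> R[i]^o} :=
  [pred f | `[< has_ubound (range (gap f)) >]].

End kernel_combinations.

(** The squared norm of f in the reproducing kernel Hilbert space, as a supremum
    that makes sense for every function f.  It is locked because comparing two
    energies up to conversion is expensive. *)
HB.lock Definition energy {R : realType} {Y : Type} (k : pd_kernel R Y)
  (f : Y -> R[i]^o) : R := sup (range (gap k f)).

Section kernel_energy.
Context {R : realType} {Y : Type} (k : pd_kernel R Y).
Implicit Types (f g : Y -> R[i]^o) (e : seq (R[i] * Y)).
Local Notation energy := (energy k).
Local Notation gap := (gap k).
Local Notation comb_sqr := (comb_sqr k).
Local Notation ker_comb := (ker_comb k).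
Local Notation finite_energy := (finite_energy k).

Lemma gap_le f e : f \in finite_energy -> gap f e <= energy f.
Proof.
move=> /asboolP h; rewrite energy.unlock.
by apply: sup_upper_bound; [split; first by exists (gap f e); exists e | exists e].
Qed.

Lemma energy_le f M : (forall e, gap f e <= M) -> energy f <= M.
Proof.
move=> h; rewrite energy.unlock; apply: ge_sup; first by exists (gap f [::]), [::].
by move=> _ [e _ <-].
Qed.

Lemma finite_energyP f M : (forall e, gap f e <= M) -> f \in finite_energy.
Proof. by move=> h; apply/asboolP; exists M => _ [e _ <-]. Qed.

Lemma energy_ge0 f : f \in finite_energy -> 0 <= energy f.
Proof. by move=> /(gap_le [::]); rewrite gap_nil. Qed.

Lemma gap_scale c f e : gap (c *: f) (scale_comb c e) = Re `|c| ^+ 2 * gap f e.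
Proof.
rewrite /gap comb_sqr_scale pairingZ pairing_scale Re_mul_conj; ring.
Qed.

Lemma scale_combK c e : c != 0 -> scale_comb c (scale_comb c^-1 e) = e.
Proof.
move=> c0; rewrite /scale_comb -map_comp -[RHS]map_id; apply: eq_map => -[a y] /=.
by rewrite mulrA divff // mul1r.
Qed.

Lemma gap0 e : gap 0 e <= 0.
Proof.
rewrite /gap (_ : pairing 0 e = 0); first by rewrite mulr0 sub0r oppr_le0 comb_sqr_ge0.
by rewrite -(scale0r 0) pairingZ mul0r.
Qed.

Lemma finite_energy0 : 0 \in finite_energy.
Proof. exact: finite_energyP gap0. Qed.

Lemma energy0 : energy 0 = 0.
Proof.
by apply/eqP; rewrite eq_le energy_ge0 ?finite_energy0 // energy_le // => e; exact: gap0.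
Qed.

Let gapZ_le c f e : f \in finite_energy -> gap (c *: f) e <= Re `|c| ^+ 2 * energy f.
Proof.
move=> hf; have [->|c0] := eqVneq c 0.
  by rewrite scale0r normr0 expr0n /= mul0r gap0.
rewrite -(scale_combK e c0) gap_scale ler_wpM2l ?sqr_ge0 //.
exact: gap_le.
Qed.

Lemma finite_energyZ c f : f \in finite_energy -> c *: f \in finite_energy.
Proof. by move=> hf; apply: finite_energyP => e; exact: gapZ_le. Qed.

Lemma energyZ c f : f \in finite_energy -> energy (c *: f) = Re `|c| ^+ 2 * energy f.
Proof.
move=> hf; apply/eqP; rewrite eq_le; apply/andP; split.
  by apply: energy_le => e; exact: gapZ_le.
have [->|c0] := eqVneq c 0.
  by rewrite scale0r normr0 expr0n /= mul0r energy0.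
have c20 : 0 < Re `|c| ^+ 2.
  by rewrite exprn_gt0 // -ltcR ge0_RRe // normr_gt0.
rewrite mulrC -ler_pdivlMr //; apply: energy_le => e.
rewrite ler_pdivlMr // mulrC -gap_scale; exact/gap_le/finite_energyZ.
Qed.

(** The parallelogram identity holds already before the suprema are taken: with
    u = e1 + e2 and v = e1 - e2, the pairs (e1, e2) and (u, v) determine each
    other up to a factor 2.  The two versions give the two inequalities. *)
Let gap_parallelogram f g e1 e2 :
  gap (f + g) e1 + gap (f - g) e2 =
  2 * gap f (scale_comb (2^-1)%:C%C (e1 ++ e2))
  + 2 * gap g (scale_comb (2^-1)%:C%C (e1 ++ scale_comb (-1) e2)).
Proof.
have n2 : Re `|(2^-1)%:C%C : R[i]| ^+ 2 = 2^-1 ^+ 2.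
  by rewrite normc_def /= expr0n /= addr0 sqr_sqrtr // sqr_ge0.
have c2 : Num.conj (2^-1)%:C%C = (2^-1)%:C%C :> R[i] by exact: conjc_real.
rewrite -[- g]scaleN1r /gap !pairingD pairingZ !comb_sqr_scale !pairing_scale.
rewrite !comb_sqr_cat !pairing_cat !pairing_scale comb_sqr_scale c2 n2.
by rewrite normrN1 rmorphN1 !mulN1r !ReD !ReZ !ReD !ReN /=; field.
Qed.

Let gap_parallelogram' f g e1 e2 :
  2 * gap f e1 + 2 * gap g e2 =
  gap (f + g) (e1 ++ e2) + gap (f - g) (e1 ++ scale_comb (-1) e2).
Proof.
rewrite -[- g]scaleN1r /gap !pairingD !pairingZ.
rewrite !comb_sqr_cat !pairing_cat !pairing_scale comb_sqr_scale.
by rewrite normrN1 rmorphN1 !mulN1r !ReD !ReN !ReD !ReN /=; ring.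
Qed.

Lemma finite_energyD f g :
  f \in finite_energy -> g \in finite_energy -> f + g \in finite_energy.
Proof.
move=> hf hg; apply: (@finite_energyP _ (2 * energy f + 2 * energy g)) => e.
rewrite -[gap _ e]addr0 -[X in _ + X](gap_nil k (f - g)) gap_parallelogram.
by rewrite lerD // ler_wpM2l // gap_le.
Qed.

Lemma finite_energyN f : f \in finite_energy -> - f \in finite_energy.
Proof. by rewrite -scaleN1r; exact: finite_energyZ. Qed.

Lemma energy_parallelogram f g : f \in finite_energy -> g \in finite_energy ->
  energy (f + g) + energy (f - g) = 2 * energy f + 2 * energy g.
Proof.
move=> hf hg; have hD := finite_energyD hf hg.
have hB := finite_energyD hf (finite_energyN hg).
apply/eqP; rewrite eq_le; apply/andP; split.
  rewrite -lerBrDr; apply: energy_le => e1; rewrite lerBrDr addrC -lerBrDr.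
  apply: energy_le => e2; rewrite lerBrDr addrC gap_parallelogram.
  by rewrite lerD // ler_wpM2l // gap_le.
rewrite -lerBrDr -ler_pdivlMl //; apply: energy_le => e1.
rewrite ler_pdivlMl // lerBrDr addrC -lerBrDr -ler_pdivlMl //.
apply: energy_le => e2; rewrite ler_pdivlMl // lerBrDr addrC gap_parallelogram'.
by rewrite lerD // gap_le.
Qed.

Lemma gap_ker_comb f e e' : gap (f + ker_comb e) (e' ++ e) =
  gap f e' + 2 * Re (pairing f e) + comb_sqr e.
Proof.
rewrite /gap pairingD !pairing_cat comb_sqr_cat !ReD (pairing_conj k e' e) Re_conjc.
by rewrite /comb_sqr; ring.
Qed.

Let gap_ker_comb' f e e' : gap (f + ker_comb e) e' =
  gap f (e' ++ scale_comb (-1) e) + 2 * Re (pairing f e) + comb_sqr e.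
Proof.
rewrite /gap pairingD !pairing_cat comb_sqr_cat !ReD (pairing_conj k e e') Re_conjc.
rewrite !pairing_scale comb_sqr_scale normrN1 rmorphN1 !mulN1r !ReN /comb_sqr /=.
by ring.
Qed.

Lemma ker_comb_finite e : ker_comb e \in finite_energy.
Proof.
apply: (@finite_energyP _ (comb_sqr e)) => e'.
rewrite -[ker_comb e]add0r gap_ker_comb' (_ : pairing 0 e = 0).
  by rewrite mulr0 addr0 gerDr gap0.
by rewrite -(scale0r 0) pairingZ mul0r.
Qed.

(** The supremum that defines the energy of f + e is that of f after the
    translation e' |-> e' + e.  After polarization this is the reproducing
    property. *)
Lemma energy_ker_comb f e : f \in finite_energy ->
  energy (f + ker_comb e) = energy f + 2 * Re (pairing f e) + comb_sqr e.
Proof.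
move=> hf; have hD := finite_energyD hf (ker_comb_finite e).
apply/eqP; rewrite eq_le; apply/andP; split.
  by apply: energy_le => e'; rewrite gap_ker_comb' !lerD2r gap_le.
rewrite -addrA -lerBrDr; apply: energy_le => e'; rewrite lerBrDr addrA.
by rewrite -gap_ker_comb gap_le.
Qed.

(** Kernel combinations are dense: a list e that nearly attains the supremum
    also is a good approximation of f. *)
Lemma energy_approx f (eps : R) : f \in finite_energy -> 0 < eps ->
  exists e, energy (f - ker_comb e) < eps.
Proof.
move=> hf e0; have [|_ [e _ <-] he] := @sup_adherent _ (range (gap f)) _ e0.
  by split; [exists (gap f [::]), [::]|exact/asboolP].
exists e; rewrite -[- _]scaleN1r -ker_comb_scale energy_ker_comb //.
rewrite pairing_scale comb_sqr_scale rmorphN1 mulN1r ReN normrN1 /=.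
by move: he; rewrite energy.unlock /gap; lra.
Qed.

End kernel_energy.

(** * The reproducing kernel Hilbert space *)

Section rkhs_type.
Context {R : realType} {Y : Type} (k : pd_kernel R Y).

Record rkhs := RKHS {
  rkhs_fun :> Y -> R[i]^o ;
  rkhs_finite : rkhs_fun \in finite_energy k
}.

HB.instance Definition _ := [isSub for rkhs_fun].
HB.instance Definition _ := [Choice of rkhs by <:].

Lemma finite_energy_submod_closed : submod_closed (@finite_energy R Y k).
Proof.
split=> [|a f g hf hg]; first exact: finite_energy0.
by apply: finite_energyD => //; exact: finite_energyZ.
Qed.

HB.instance Definition _ :=
  GRing.isSubmodClosed.Build _ _ (finite_energy k) finite_energy_submod_closed.
HB.instance Definition _ := [SubChoice_isSubLmodule of rkhs by <:].

End rkhs_type.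

Section rkhs_energy.
Context {R : realType} {Y : Type} {k : pd_kernel R Y}.
Implicit Types f g h : rkhs k.

Local Notation N f := (energy k (rkhs_fun f)).
Definition ker_vec e : rkhs k := RKHS (ker_comb_finite k e).
Definition polar f g : R := (N (f + g) - N (f - g)) / 4.
Local Notation ii := (0 +i* 1)%C.

Lemma rkhs_energy_ge0 f : 0 <= N f.
Proof. exact/energy_ge0/rkhs_finite. Qed.

Lemma rkhs_energyZ c f : N (c *: f) = Re `|c| ^+ 2 * N f.
Proof. exact: (energyZ c (rkhs_finite f)). Qed.

Lemma rkhs_energyN f : N (- f) = N f.
Proof. by rewrite -scaleN1r rkhs_energyZ normrN1 /= expr1n mul1r. Qed.

Lemma rkhs_parallelogram f g : N (f + g) + N (f - g) = 2 * N f + 2 * N g.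
Proof. by apply: energy_parallelogram; exact: rkhs_finite. Qed.

Lemma normi : `|ii| = 1 :> R[i].
Proof. by rewrite normc_def /= expr0n expr1n add0r sqrtr1. Qed.

Lemma mulii : ii * ii = -1 :> R[i].
Proof. by rewrite -expr2 sqr_i. Qed.

Lemma ker_vec_scale c e : c *: ker_vec e = ker_vec (scale_comb c e).
Proof. by apply/val_inj; rewrite /= ker_comb_scale. Qed.

Lemma polar_ker_vec f e : polar f (ker_vec e) = Re (pairing f e).
Proof.
rewrite /polar -[- ker_vec e]scaleN1r ker_vec_scale.
rewrite !energy_ker_comb ?rkhs_finite //.
rewrite pairing_scale comb_sqr_scale rmorphN1 mulN1r ReN normrN1 /=.
by field.
Qed.

Lemma polarC f g : polar f g = polar g f.
Proof. by rewrite /polar (addrC f) -[N (f - g)]rkhs_energyN opprB. Qed.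

Lemma polarZi f g : polar (ii *: f) (ii *: g) = polar f g.
Proof.
by rewrite /polar -scalerBr -scalerDr !rkhs_energyZ normi /= expr1n !mul1r.
Qed.

Lemma polar0l g : polar 0 g = 0.
Proof. by rewrite /polar add0r sub0r rkhs_energyN subrr mul0r. Qed.

Lemma polarNl f g : polar (- f) g = - polar f g.
Proof.
have e1 : - f + g = - (f - g) by rewrite opprB addrC.
by rewrite /polar -opprD e1 !rkhs_energyN -mulNr opprB.
Qed.

(** Jordan and von Neumann's derivation of additivity from the parallelogram
    identity. *)
Lemma polarDl f g h : polar (f + g) h = polar f h + polar g h.
Proof.
have half u v w : polar u w + polar v w = polar (u + v) (w + w) / 2.
  have p1 := rkhs_parallelogram (u + w) (v + w).
  have p2 := rkhs_parallelogram (u - w) (v - w).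
  have e1 : u + w + (v + w) = u + v + (w + w) by rewrite addrACA.
  have e2 : u + w - (v + w) = u - v by rewrite opprD addrACA subrr addr0.
  have e3 : u - w + (v - w) = u + v - (w + w) by rewrite addrACA opprD.
  have e4 : u - w - (v - w) = u - v by rewrite opprB addrA subrK.
  rewrite e1 e2 in p1; rewrite e3 e4 in p2.
  move: p1 p2; rewrite /polar; move: (N _) (N _) (N _) (N _) (N _) (N _) (N _).
  by move=> a b c d a' c' d'; lra.
rewrite half; have := half (f + g) 0 h.
by rewrite polar0l !addr0 => ->.
Qed.

Lemma polar_le f g : `|polar f g| <= (N f + N g) / 2.
Proof.
have := rkhs_parallelogram f g; have := rkhs_energy_ge0 (f + g).
have := rkhs_energy_ge0 (f - g); rewrite ler_norml /polar.
move: (N _) (N _) (N _) (N _) => a b c d h1 h2 h3.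
by apply/andP; split; lra.
Qed.

End rkhs_energy.

(** The real part is the polarization of the energy, and the imaginary part is
    forced by conjugate linearity in g. *)
HB.lock Definition rkhs_inner {R : realType} {Y : Type} {k : pd_kernel R Y}
  (f g : rkhs k) : R[i] := (polar f g +i* polar f ((0 +i* 1) *: g))%C.

Section rkhs_inner.
Context {R : realType} {Y : Type} {k : pd_kernel R Y}.
Implicit Types f g h : rkhs k.
Local Notation N f := (energy k (rkhs_fun f)).
Local Notation ii := (0 +i* 1)%C.

Lemma rkhs_innerDl f g h : rkhs_inner (f + g) h = rkhs_inner f h + rkhs_inner g h.
Proof. by rewrite rkhs_inner.unlock !polarDl. Qed.

Lemma rkhs_inner_conj f g : rkhs_inner g f = Num.conj (rkhs_inner f g).
Proof.
rewrite rkhs_inner.unlock polarC /=; congr Complex.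
by rewrite -[polar g _]polarZi scalerA mulii scaleN1r polarC polarNl.
Qed.

Lemma rkhs_innerDr f g h : rkhs_inner h (f + g) = rkhs_inner h f + rkhs_inner h g.
Proof. by rewrite !(rkhs_inner_conj _ h) rkhs_innerDl rmorphD. Qed.

Lemma rkhs_inner_ker f e : rkhs_inner f (ker_vec e) = pairing f e.
Proof.
rewrite rkhs_inner.unlock ker_vec_scale !polar_ker_vec pairing_scale.
by case: (pairing f e) => a b /=; rewrite mul0r sub0r mulN1r opprK.
Qed.

Lemma rkhs_inner_le f g : `|rkhs_inner f g| <= (N f + N g)%:C%C.
Proof.
rewrite [rkhs_inner _ _]complexE rkhs_inner.unlock; apply: le_trans (ler_normD _ _) _.
have -> : N f + N g = (N f + N g) / 2 + (N f + N (ii *: g)) / 2.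
  by rewrite rkhs_energyZ normi /= expr1n mul1r -splitr.
rewrite rmorphD normrM normi mul1r lerD //.
  by rewrite normc_def lecR /= expr0n addr0 sqrtr_sqr polar_le.
by rewrite normc_def lecR /= expr0n addr0 sqrtr_sqr polar_le.
Qed.

Lemma rkhs_energy_approx f (eps : R) : 0 < eps -> exists e, N (f - ker_vec e) < eps.
Proof. by move=> e0; have [e he] := energy_approx (rkhs_finite f) e0; exists e. Qed.

(** The difference D of the two sides is additive in g and vanishes at kernel
    combinations, where the inner product is the pairing.  For all n, D g is thus
    the n-th part of the value of D at n times g - e, which is bounded if e is
    close enough to g; hence D g = 0. *)
Lemma rkhs_innerZl c f g : rkhs_inner (c *: f) g = c * rkhs_inner f g.
Proof.
pose D h := rkhs_inner (c *: f) h - c * rkhs_inner f h.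
have DD h1 h2 : D (h1 + h2) = D h1 + D h2 by rewrite /D !rkhs_innerDr; ring.
have Dn h n : D (h *+ n) = n%:R * D h.
  elim: n => [|n IH]; last by rewrite mulrS DD IH -natr1; ring.
  by apply: (addrI (D 0)); rewrite -DD mul0r !addr0.
have Dker e : D (ker_vec e) = 0 by rewrite /D !rkhs_inner_ker pairingZ subrr.
pose a := N (c *: f) + Re `|c| * N f; pose b := 1 + Re `|c|.
have c0 : 0 <= Re `|c| by rewrite -ler0c ge0_RRe.
have Dle h : `|D h| <= (a + b * N h)%:C%C.
  apply: le_trans (ler_normB _ _) _; rewrite normrM -[`|c|]ge0_RRe //.
  have -> : a + b * N h = N (c *: f) + N h + Re `|c| * (N f + N h).
    by rewrite /a /b; ring.
  by rewrite rmorphD rmorphM lerD ?ler_wpM2l ?ler0c ?rkhs_inner_le.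
have small n : Re `|D g| * n.+1%:R <= a + b.
  (* The factor n.+1 multiplies the energy by its square. *)
  have n0 : 0 < (n.+1%:R ^+ 2)^-1 :> R by rewrite invr_gt0 exprn_gt0 ?ltr0n.
  have [e he] := rkhs_energy_approx g n0.
  have DgE : D g = D (g - ker_vec e).
    by have := DD (g - ker_vec e) (ker_vec e); rewrite subrK Dker addr0.
  have := Dle ((g - ker_vec e) *+ n.+1); rewrite Dn -DgE => h.
  rewrite -lecR; have -> : (Re `|D g| * n.+1%:R)%:C%C = `|n.+1%:R * D g|.
    rewrite normrM normr_nat -[in RHS](ge0_RRe (normr_ge0 (D g))).
    by rewrite -(rmorph_nat (real_complex R)) -rmorphM mulrC.
  apply: le_trans h _; rewrite lecR lerD2l.
  rewrite -scaler_nat rkhs_energyZ normr_nat -[leRHS]mulr1 ler_wpM2l //.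
    by rewrite addr_ge0.
  rewrite (_ : Re n.+1%:R = n.+1%:R); last by rewrite -(rmorph_nat (real_complex R)).
  by rewrite -ler_pdivlMl ?mulr1 ?exprn_gt0 ?ltr0n // ltW.
suff : D g = 0 by rewrite /D => /eqP; rewrite subr_eq0 => /eqP.
apply/normr0_eq0; rewrite -[LHS]ge0_RRe //.
have D0 : 0 <= Re `|D g| by rewrite -ler0c ge0_RRe.
suff -> : Re `|D g| = 0 by [].
apply/eqP; rewrite eq_le D0 andbT leNgt; apply/negP => Dp.
have := archi_boundP (_ : 0 <= (a + b) / Re `|D g|).
set n := Num.bound _ => hn.
have ab0 : 0 <= a + b.
  by apply: le_trans (small 0); rewrite mulr1.
have := hn (divr_ge0 ab0 D0); rewrite ltr_pdivrMr // => h.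
have := small n; rewrite leNgt; case/negP; apply: lt_trans h _.
by rewrite mulrC ltr_pM2l // ltr_nat.
Qed.

End rkhs_inner.

Section rkhs_hilbert.
Context {R : realType} {Y : Type} {k : pd_kernel R Y}.
Implicit Types f g h : rkhs k.
Local Notation N f := (energy k (rkhs_fun f)).

Lemma rkhs_inner_self f : rkhs_inner f f = (N f)%:C%C.
Proof.
have e : N (f + (0 +i* 1)%C *: f) = N (f - (0 +i* 1)%C *: f).
  rewrite -[X in N (X + _) = _]scale1r -[X in N (X - _)]scale1r.
  rewrite -scalerDl -scalerBl !rkhs_energyZ.
  by rewrite !normc_def /= subr0 addr0 !expr1n add0r sub0r sqrrN.
have p2 : polar f ((0 +i* 1)%C *: f) = 0 by rewrite /polar e subrr mul0r.
have p1 : polar f f = N f.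
  rewrite /polar (_ : N (f - f) = 0); last by rewrite subrr; exact: energy0.
  rewrite subr0 -mulr2n -scaler_nat rkhs_energyZ normr_nat.
  rewrite (_ : Re 2%:R = 2%:R); last by rewrite -(rmorph_nat (real_complex R)).
  by field.
by rewrite rkhs_inner.unlock p1 p2.
Qed.

Lemma rkhs_energyD f g : N (f + g) = N f + N g + 2 * Re (rkhs_inner f g).
Proof.
have -> : Re (rkhs_inner f g) = polar f g by rewrite rkhs_inner.unlock.
have := rkhs_parallelogram f g; rewrite /polar.
by move: (N _) (N _) (N _) (N _) => a b c d; lra.
Qed.

(** Evaluation at y is continuous: compare the energy with the gap of a suitable
    multiple of the kernel section at y.  The 1 added to k y y covers the case
    that this section vanishes. *)
Lemma norm_point_le f y : Re `|f y| ^+ 2 <= (Re (k y y) + 1) * N f.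
Proof.
set q := Re (k y y).
have kyy c : comb_sqr k [:: (c, y)] = Re `|c| ^+ 2 * q.
  by rewrite /comb_sqr /pairing /ker_comb !big_seq1 /= mulrCA Re_mul_conj.
have q0 : 0 <= q.
  by have := comb_sqr_ge0 k [:: (1, y)]; rewrite kyy normr1 /= expr1n mul1r.
pose s := (q + 1)^-1; have s0 : 0 < s by rewrite invr_gt0 ltr_wpDl.
pose r := Re `|f y|; have rE : `|f y| = r%:C%C by rewrite ge0_RRe.
have := gap_le [:: (s%:C%C * f y, y)] (rkhs_finite f).
have Jr : Num.conj s%:C%C = s%:C%C by exact: conjc_real.
have e1 : Re (pairing f [:: (s%:C%C * f y, y)]) = s * r ^+ 2.
  have JM (z w : R[i]) : Num.conj (z * w) = Num.conj z * Num.conj w.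
    exact: rmorphM.
  rewrite /pairing big_seq1 JM Jr -mulrA (mulrC (Num.conj _)) -normCK.
  by rewrite ReZ rE -rmorphXn.
have e2 : Re `|s%:C%C * f y| = s * r.
  by rewrite normrM ger0_norm ?ler0c ?ReZ // ltW.
rewrite /gap kyy e1 e2 => h.
have sq : s * q = 1 - s.
  by rewrite /s; field; rewrite gt_eqF // ltr_wpDl.
have : s * r ^+ 2 <= N f.
  apply: le_trans h; rewrite exprMn.
  have -> : s ^+ 2 * r ^+ 2 * q = s * r ^+ 2 * (s * q) by ring.
  rewrite sq; have : 0 <= s * r ^+ 2 * s.
    by rewrite !mulr_ge0 ?exprn_ge0 ?(ltW s0) // -ler0c -rE.
  by lra.
by rewrite /s ler_pdivrMl ?ltr_wpDl.
Qed.

Definition rkhs_norm f : R[i] := (Num.sqrt (N f))%:C%C.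

Lemma rkhs_norm_sqr f : rkhs_norm f ^+ 2 = (N f)%:C%C.
Proof. by rewrite /rkhs_norm -rmorphXn /= sqr_sqrtr // rkhs_energy_ge0. Qed.

Lemma rkhs_energy_eq0 f : N f = 0 -> f = 0.
Proof.
move=> f0; apply/val_inj/funext => y; apply/normr0_eq0.
rewrite -[LHS]ge0_RRe //; congr (_%:C)%C; apply/eqP.
rewrite -sqrf_eq0 eq_le sqr_ge0 andbT.
by apply: le_trans (norm_point_le f y) _; rewrite f0 mulr0.
Qed.

Lemma rkhs_norm_eq0 f : rkhs_norm f = 0 -> f = 0.
Proof.
move=> /complexI/eqP; rewrite sqrtr_eq0 => f0.
by apply: rkhs_energy_eq0; apply/eqP; rewrite eq_le f0 rkhs_energy_ge0.
Qed.

Lemma rkhs_normZ c f : rkhs_norm (c *: f) = `|c| * rkhs_norm f.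
Proof.
rewrite /rkhs_norm rkhs_energyZ sqrtrM ?sqr_ge0 // sqrtr_sqr.
rewrite ger0_norm; last by rewrite -ler0c ge0_RRe.
by rewrite -[in RHS](ge0_RRe (normr_ge0 c)) -rmorphM.
Qed.

(** Cauchy-Schwarz, from the energy of the norm of g times f minus the norm of f
    times g. *)
Lemma Re_rkhs_inner_le f g :
  Re (rkhs_inner f g) <= Num.sqrt (N f) * Num.sqrt (N g).
Proof.
have Re0 (x y : R) : Re (rkhs_inner (x%:C%C *: f) (y%:C%C *: g)) =
    x * y * Re (rkhs_inner f g).
  rewrite rkhs_innerZl ReZ rkhs_inner_conj Re_conjc rkhs_innerZl ReZ mulrA.
  by rewrite rkhs_inner_conj Re_conjc.
have in0l h : rkhs_inner 0 h = 0.
  by apply: (addIr (rkhs_inner 0 h)); rewrite -rkhs_innerDl !add0r.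
have Rn (x : R) : Re `|x%:C%C : R[i]| ^+ 2 = x ^+ 2.
  by rewrite normc_def /= expr0n addr0 sqr_sqrtr ?sqr_ge0.
set a := Num.sqrt (N f); set b := Num.sqrt (N g).
have aE : a ^+ 2 = N f by rewrite sqr_sqrtr ?rkhs_energy_ge0.
have bE : b ^+ 2 = N g by rewrite sqr_sqrtr ?rkhs_energy_ge0.
have [a0|a0] := eqVneq a 0.
  have -> : f = 0 by apply: rkhs_norm_eq0; rewrite /rkhs_norm -/a a0.
  by rewrite in0l /= a0 mul0r.
have [b0|b0] := eqVneq b 0.
  have -> : g = 0 by apply: rkhs_norm_eq0; rewrite /rkhs_norm -/b b0.
  by rewrite rkhs_inner_conj Re_conjc in0l /= b0 mulr0.
have ab0 : 0 < a * b by rewrite mulr_gt0 // lt_def ?a0 ?b0 sqrtr_ge0.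
have := rkhs_energy_ge0 (b%:C%C *: f + (- a)%:C%C *: g).
rewrite rkhs_energyD !rkhs_energyZ Re0 !Rn sqrrN -aE -bE => h.
rewrite -(ler_pM2l ab0) -subr_ge0 -(@pmulr_rge0 _ 2) //.
by apply: le_trans h _; rewrite le_eqVlt; apply/orP; left; apply/eqP; ring.
Qed.

Lemma rkhs_normD f g : rkhs_norm (f + g) <= rkhs_norm f + rkhs_norm g.
Proof.
rewrite /rkhs_norm -rmorphD lecR -(@ler_pXn2r _ 2) ?nnegrE ?addr_ge0 ?sqrtr_ge0 //.
rewrite sqrrD !sqr_sqrtr ?rkhs_energy_ge0 // rkhs_energyD addrAC lerD2r lerD2l.
by rewrite -[leRHS]mulr_natl ler_pM2l // Re_rkhs_inner_le.
Qed.

HB.instance Definition _ := Lmodule_isNormed.Build R[i] (rkhs k)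
  rkhs_normD rkhs_normZ rkhs_norm_eq0.

Lemma rkhs_norm_le f (e : R) : 0 < e -> (`|f| <= e%:C%C) = (N f <= e ^+ 2).
Proof.
move=> e0; rewrite [`|f|]/(rkhs_norm f) /rkhs_norm lecR.
rewrite -(@ler_pXn2r _ 2) ?nnegrE ?sqrtr_ge0 ?(ltW e0) //.
by rewrite sqr_sqrtr // rkhs_energy_ge0.
Qed.

Let bilin : bilinear_for *%R (Num.conj \; *%R) (@rkhs_inner R Y k).
Proof.
split=> [h c f g | h c f g] /=.
  by rewrite rkhs_innerDl rkhs_innerZl.
rewrite rkhs_innerDr; congr (_ + _).
by rewrite rkhs_inner_conj rkhs_innerZl rmorphM /= -rkhs_inner_conj.
Qed.

HB.instance Definition _ := bilinear_isBilinear.Build R[i] (rkhs k) (rkhs k)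
  R[i] *%R (Num.conj \; *%R) (@rkhs_inner R Y k) bilin.

Let herm f g : rkhs_inner f g = (-1) ^+ false * Num.conj (rkhs_inner g f).
Proof. by rewrite expr0 mul1r -rkhs_inner_conj. Qed.

HB.instance Definition _ := isHermitianSesquilinear.Build R[i] (rkhs k)
  false Num.conj (@rkhs_inner R Y k) herm.

Let dot f : f != 0 -> 0 < rkhs_inner f f.
Proof.
move=> f0; rewrite rkhs_inner_self ltcR lt_def rkhs_energy_ge0 andbT.
by apply: contra f0 => /eqP/rkhs_energy_eq0 ->.
Qed.

HB.instance Definition _ := isDotProduct.Build R[i] (rkhs k)
  (@rkhs_inner R Y k) dot.

Lemma rkhs_energyB_le f g h : N (f - h) <= 2 * N (g - f) + 2 * N (g - h).
Proof.
have e1 : - (g - f) + (g - h) = f - h by rewrite opprB addrA subrK.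
have := rkhs_parallelogram (- (g - f)) (g - h); rewrite e1 rkhs_energyN => <-.
by rewrite lerDl rkhs_energy_ge0.
Qed.

(** A Cauchy filter F converges pointwise; each gap is continuous in the
    pointwise values, so the Cauchy estimate survives in the limit and shows at
    once that the limit has finite energy and that F converges to it. *)
Section complete.
Variables (F : set_system (rkhs k)) (FF : ProperFilter F).
Hypothesis Fc : cauchy F.

Let energy_cauchy (e : R) : 0 < e -> exists f, F [set g | N (f - g) <= e].
Proof.
move=> e0; have s0 : 0 < Num.sqrt e by rewrite sqrtr_gt0.
have /cauchyP/(_ (Num.sqrt e)%:C%C) := Fc; rewrite ltcR => /(_ s0)[f hf].
exists f; apply: filterS hf => g; rewrite -ball_normE /= => /ltW.
by rewrite rkhs_norm_le // sqr_sqrtr // ltW.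
Qed.

(** A real additive functional bounded by the energy maps F to a Cauchy filter;
    it is applied to the real and imaginary parts of point evaluations. *)
Let functional_cvg (L : rkhs k -> R) (C : R) : 0 < C ->
  (forall f g, L (f - g) = L f - L g) -> (forall f, L f ^+ 2 <= C * N f) ->
  cvg (L @ F).
Proof.
move=> C0 LB Lb; apply: cauchy_cvg; apply/cauchyP => e e0.
have d0 : 0 < (e / 2) ^+ 2 / C by rewrite divr_gt0 // exprn_gt0 // divr_gt0.
have [f hf] := energy_cauchy d0; exists (L f).
suff : F [set g | ball (L f) e (L g)] by [].
apply: filterS hf => g /= hg.
have h : C * N (f - g) <= (e / 2) ^+ 2 by rewrite mulrC -ler_pdivlMr.
rewrite /ball /= -LB.
apply: (@le_lt_trans _ _ (e / 2)); last by rewrite ltr_pdivrMr // ltr_pMr // ltr1n.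
rewrite -(@ler_pXn2r _ 2) ?nnegrE ?(ltW (divr_gt0 e0 _)) //.
by rewrite real_normK ?num_real // (le_trans (Lb _)).
Qed.

Let point_sqr f y : Re (f y) ^+ 2 <= (Re (k y y) + 1) * N f /\
  Im (f y) ^+ 2 <= (Re (k y y) + 1) * N f.
Proof.
have := norm_point_le f y; rewrite normc_def /= sqr_sqrtr; last first.
  by rewrite addr_ge0 ?sqr_ge0.
have := sqr_ge0 (Re (f y)); have := sqr_ge0 (Im (f y)).
by move: (_ ^+ 2) (_ ^+ 2) => a b; split; lra.
Qed.

Let flim : Y -> R[i]^o := fun y =>
  (lim ((fun f : rkhs k => Re (f y)) @ F) +i* lim ((fun f : rkhs k => Im (f y)) @ F))%C.

Let kyy0 y : 0 < Re (k y y) + 1.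
Proof.
rewrite ltr_wpDl //; have := comb_sqr_ge0 k [:: (1, y)].
rewrite /comb_sqr /pairing /ker_comb !big_seq1 /= mulrCA Re_mul_conj.
by rewrite normr1 /= expr1n mul1r.
Qed.

Let cvg_point y : (fun f : rkhs k => Re (f y)) @ F --> Re (flim y) /\
  (fun f : rkhs k => Im (f y)) @ F --> Im (flim y).
Proof.
split; apply: (functional_cvg (kyy0 y)) => [f g|f].
- exact: ReB.
- by have [] := point_sqr f y.
- have -> : (f - g) y = f y - g y by [].
  by case: (f y) => a b; case: (g y).
- by have [] := point_sqr f y.
Qed.

Let cvg_pairing e :
  (fun f : rkhs k => Re (pairing f e)) @ F --> Re (pairing flim e).
Proof.
elim: e => [|p e IH].
  rewrite /pairing big_nil; under eq_fun do rewrite big_nil.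
  exact: cvg_cst.
rewrite /pairing big_cons; under eq_fun do rewrite big_cons ReD.
rewrite ReD; apply: cvgD => //.
have ReM (z w : R[i]) : Re (Num.conj z * w) = Re z * Re w + Im z * Im w.
  by case: z; case: w => a b c d /=; rewrite mulNr opprK.
rewrite ReM; under eq_fun do rewrite ReM.
have [h1 h2] := cvg_point p.2.
by apply: cvgD; apply: cvgM => //; exact: cvg_cst.
Qed.

Lemma rkhs_complete : cvg F.
Proof.
have close (e : R) : 0 < e ->
    F [set g : rkhs k | forall c, gap k (flim - g) c <= e].
  move=> e0; have e4 : 0 < e / 4 by rewrite divr_gt0.
  have [f hf] := energy_cauchy e4; apply: filterS (hf) => g /= gf c.
  rewrite /gap -[- _]scaleN1r pairingD pairingZ mulN1r ReD ReN.
  have lim_gap : (fun h : rkhs k => 2 * (Re (pairing h c) - Re (pairing g c))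
      - comb_sqr k c) @ F -->
      2 * (Re (pairing flim c) - Re (pairing g c)) - comb_sqr k c.
    apply: cvgB; last exact: cvg_cst.
    apply: cvgM; first exact: cvg_cst.
    by apply: cvgB; [exact: cvg_pairing|exact: cvg_cst].
  apply: (cvgr_to_le lim_gap).
  apply: filterS hf => h /= hf.
  have -> : 2 * (Re (pairing h c) - Re (pairing g c)) - comb_sqr k c =
      gap k (h - g) c.
    rewrite /gap -[- (g : rkhs k)]scaleN1r.
    by rewrite pairingD pairingZ mulN1r ReD ReN.
  apply: le_trans (gap_le _ (rkhs_finite _)) _.
  by apply: le_trans (rkhs_energyB_le _ f _) _; lra.
have [g /= hg] := filter_ex (close 1 ltr01).
have limf : flim \in finite_energy k.
  rewrite -[flim](subrK (g : Y -> R[i]^o)).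
  by apply: finite_energyD (rkhs_finite g); exact: finite_energyP hg.
apply/cvg_ex; exists (RKHS limf); apply/cvgrPdist_le => e e0.
have re0 : 0 < Re e by move: e0; rewrite ltcE => /andP[].
rewrite -(ge0_RRe (ltW e0)).
apply: filterS (close (Re e ^+ 2) (exprn_gt0 _ re0)) => h /= hh.
by rewrite rkhs_norm_le //; exact: energy_le hh.
Qed.
End complete.

HB.instance Definition _ := Uniform_isComplete.Build (rkhs k) rkhs_complete.

Let norm_inner f :
  `|f| ^+ 2 = (@rkhs_inner R Y k : {dot rkhs k for Num.conj}) f f.
Proof. by rewrite rkhs_norm_sqr; exact: esym (rkhs_inner_self f). Qed.

HB.instance Definition _ := isHilbert.Build R (rkhs k) norm_inner.

Lemma rkhs_innerE f g : inner f g = rkhs_inner f g.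
Proof. by []. Qed.

End rkhs_hilbert.

(** * The orthant and semigroups over it *)

Section orthant_facts.
Context {R : realType} {d : nat}.
Implicit Types s t : 'rV[R]_d.

Lemma orthant0 : @orthant R d 0.
Proof. by move=> i; rewrite mxE. Qed.
Lemma orthantD s t : orthant s -> orthant t -> orthant (s + t).
Proof. by move=> hs ht i; rewrite mxE addr_ge0. Qed.
Lemma orthant_pos t : orthant (pos_part t).
Proof. by move=> i; rewrite mxE le_max lexx orbT. Qed.
Lemma orthant_neg t : orthant (neg_part t).
Proof. by move=> i; rewrite mxE le_max lexx orbT. Qed.
Lemma orthant_axis (c : R) i : 0 <= c -> orthant (c *: delta_mx 0 i : 'rV[R]_d).
Proof. by move=> c0 j; rewrite !mxE mulr_ge0 // ler0n. Qed.
Lemma pos_partN t : pos_part (- t) = neg_part t.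
Proof. by apply/rowP => i; rewrite !mxE. Qed.
Lemma neg_partN t : neg_part (- t) = pos_part t.
Proof. by apply/rowP => i; rewrite !mxE opprK. Qed.
Lemma pos_part0 : pos_part 0 = 0 :> 'rV[R]_d.
Proof. by apply/rowP => i; rewrite !mxE maxxx. Qed.
Lemma neg_part0 : neg_part 0 = 0 :> 'rV[R]_d.
Proof. by rewrite -[0 in LHS]oppr0 neg_partN pos_part0. Qed.

Lemma pos_part_disjoint s t : orthant s -> orthant t ->
  (forall i, s 0 i = 0 \/ t 0 i = 0) -> pos_part (s - t) = s.
Proof.
move=> hs ht st; apply/rowP => i; rewrite !mxE.
case: (st i) => ->; first by rewrite sub0r max_r // oppr_le0.
by rewrite subr0 max_l.
Qed.

Lemma cvg_pos_part0 : @pos_part R d t @[t --> (0 : 'rV[R]_d)] --> (0 : 'rV[R]_d).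
Proof.
have FF : Filter (nbhs (0 : 'rV[R]_d)) by exact: nbhs_filter.
apply: (proj2 (@cvg_ballP R 'rV[R]_d _ _ FF _ _)) => e e0.
have := nbhsx_ballx (0 : 'rV[R]_d) e e0.
apply: filterS => t /= [_ ht]; split=> // i j.
have := ht i j; rewrite /ball /= !mxE (ord1 i).
rewrite !sub0r !normrN; apply: le_lt_trans.
by case: (lerP (t 0 j) 0) => h; rewrite ?normr0 // !gtr0_norm.
Qed.

Lemma cvg_neg_part0 : @neg_part R d t @[t --> (0 : 'rV[R]_d)] --> (0 : 'rV[R]_d).
Proof.
under eq_fun do rewrite -pos_partN.
apply: (@cvg_comp _ _ _ -%R (@pos_part R d) _ _ _ _ cvg_pos_part0).
rewrite -{2}[0 : 'rV[R]_d]oppr0; apply: (@oppr_continuous R 'rV[R]_d).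
Qed.
End orthant_facts.

Section semigroup.
Context {R : realType} {d : nat} {H : hilbertType R}.
Variable T : 'rV[R]_d -> H -> H.
Hypothesis hT : C0_semigroup T.

Lemma C0_linear t : orthant t -> linear (T t).
Proof. by move=> /(C0_bounded hT) []. Qed.

Lemma C0_comm s t : orthant s -> orthant t -> T s \o T t =1 T t \o T s.
Proof. by move=> hs ht x; rewrite -!(C0_add hT) // addrC. Qed.

(** Continuity within the orthant, in a form that can be composed with a map g
    into the orthant. *)
Lemma C0_cvg (S : Type) (F : set_system S) (FF : Filter F)
    (g : S -> 'rV[R]_d) p x :
  orthant p -> (\forall s \near F, orthant (g s)) -> g @ F --> p ->
  T (g s) x @[s --> F] --> T p x.
Proof.
move=> hp hg gp.
have Tc := @C0_continuous _ _ _ _ hT x p.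
apply: (@cvg_trans _ ((fun t => T t x) @ within (@orthant R d) (nbhs p))).
  move=> A hA; have h : F (fun s => orthant (g s) -> A (T (g s) x)) := gp _ hA.
  change (F [set s | A (T (g s) x)]).
  by apply: filterS2 h hg => s h1 h2; exact: h1.
by move: Tc; rewrite /continuous_at /= nbhs_subspace_in.
Qed.

Local Notation S i := (marginal T i).

Lemma marginal_bounded i (h : R) : 0 <= h -> bounded_operator (S i h).
Proof. by move=> h0; apply: (C0_bounded hT); exact: orthant_axis. Qed.

Lemma marginal0 i x : S i 0 x = x.
Proof. by rewrite /marginal scale0r (C0_id hT). Qed.

Lemma marginalD i (g h : R) x : 0 <= g -> 0 <= h -> S i (g + h) x = S i g (S i h x).
Proof.
by move=> g0 h0; rewrite /marginal scalerDl (C0_add hT) //; exact: orthant_axis.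
Qed.

Lemma marginal_C0_comm i (h : R) t x : 0 <= h -> orthant t ->
  S i h (T t x) = T t (S i h x).
Proof. by move=> h0 ht; apply: C0_comm => //; exact: orthant_axis. Qed.

Lemma cvg_marginal i x (F : set_system R) (FF : Filter F) (h : R) :
  0 <= h -> (\forall s \near F, 0 <= s) -> F --> h ->
  S i s x @[s --> F] --> S i h x.
Proof.
move=> h0 F0 Fh; apply: C0_cvg; first exact: orthant_axis.
  by apply: filterS F0 => s s0; exact: orthant_axis.
apply: (@cvg_comp _ _ _ id (fun s : R => s *: delta_mx 0 i : 'rV[R]_d) _ (nbhs h)) => //.
exact: scalel_continuous.
Qed.
End semigroup.

(** * Regular dilations and positive definiteness *)

Section kernel_symmetry.
Context {R : realType} {Y : Type} {k : pd_kernel R Y}.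
Variable s : Y -> Y.
Hypothesis ks : forall y z, k (s y) (s z) = k y z.

Let shift (e : seq (R[i] * Y)) := [seq (p.1, s p.2) | p <- e].

Let pairing_shift f e : pairing (f \o s) e = pairing f (shift e).
Proof. by rewrite /pairing big_map. Qed.

Let comb_sqr_shift e : comb_sqr k (shift e) = comb_sqr k e.
Proof.
rewrite /comb_sqr /pairing /ker_comb big_map; congr Re; apply: eq_bigr => p _.
by rewrite big_map; congr (_ * _); apply: eq_bigr => q _ /=; rewrite ks.
Qed.

Let gap_shift f e : gap k (f \o s) e = gap k f (shift e).
Proof. by rewrite /gap pairing_shift comb_sqr_shift. Qed.

(** Composition with a symmetry s of the kernel amounts to moving the points of
    e by s, so it can only decrease the energy. *)
Lemma comp_finite_energy (f : rkhs k) : f \o s \in finite_energy k.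
Proof.
apply: (@finite_energyP _ _ _ _ (energy k f)) => e.
by rewrite gap_shift gap_le // rkhs_finite.
Qed.

Definition rkhs_comp (f : rkhs k) : rkhs k := RKHS (comp_finite_energy f).

Lemma rkhs_comp_energy_le f : energy k (rkhs_comp f) <= energy k f.
Proof. by apply: energy_le => e; rewrite gap_shift gap_le // rkhs_finite. Qed.

Lemma rkhs_comp_linear : linear rkhs_comp.
Proof. by move=> a f g; exact/val_inj. Qed.
End kernel_symmetry.

Section positive_definite.
Context {R : realType} {d : nat} {H : hilbertType R}.
Implicit Types (T : 'rV[R]_d -> H -> H) (x y : H).

(** This is <phi(t) x, y> for the operator function phi that a regular dilation
    has to reproduce; in this form it needs no adjoint. *)
Definition regular_form T (t : 'rV[R]_d) x y : R[i] :=
  inner (T (pos_part t) x) (T (neg_part t) y).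

Definition positive_definite T : Prop :=
  forall n (t : 'I_n -> 'rV[R]_d) (x : 'I_n -> H),
    0 <= \sum_i \sum_j Re (regular_form T (t i - t j) (x i) (x j)).

Lemma regular_formC T t x y : regular_form T (- t) y x = Num.conj (regular_form T t x y).
Proof. by rewrite /regular_form pos_partN neg_partN inner_conj. Qed.

Lemma unitary_rep_isometry (H' : hilbertType R) (U : 'rV[R]_d -> H' -> H') :
  unitary_representation U ->
  forall s t f g, inner (U s f) (U t g) = inner (U (s - t) f) g.
Proof.
move=> hU s t f g.
have iso u a b : inner (U u a) (U u b) = inner a b.
  have [hb h1 _] := urep_unitary hU u.
  by rewrite -(innerA hb); have := h1 b; rewrite /= => ->.
rewrite -[LHS](iso (- t)) -![U (- t) _](urep_add hU) addrC.
by rewrite addNr (urep_id hU).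
Qed.

Lemma dilation_formE T (hT : C0_semigroup T) (H' : hilbertType R)
    (U : 'rV[R]_d -> H' -> H') r :
  regular_unitary_dilation T U r ->
  forall t x y, regular_form T t x y = inner (U t (r x)) (r y).
Proof.
move=> [hU hr hd] t x y; rewrite /regular_form.
have hN := C0_bounded hT (orthant_neg t).
rewrite inner_conj -(innerA hN); have := hd t x; rewrite /= => ->.
by rewrite (innerA hr) -inner_conj.
Qed.

(** The sum is the squared norm of the sum of the U (t i) (r (x i)). *)
Lemma dilation_positive_definite T : C0_semigroup T ->
  has_regular_unitary_dilation T -> positive_definite T.
Proof.
move=> hT [H' [U [r hd]]] n t x; have [hU hr _] := hd.
rewrite (_ : \sum_i _ =
  Re (inner (\sum_i U (t i) (r (x i))) (\sum_i U (t i) (r (x i))))).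
  by rewrite Re_inner_self exprn_ge0 // rnorm_ge0.
rewrite (form_suml inner_hermitian) Re_sum; apply: eq_bigr => i _.
rewrite (form_sumr inner_hermitian) Re_sum; apply: eq_bigr => j _.
by rewrite (dilation_formE hT hd) unitary_rep_isometry.
Qed.
End positive_definite.

Section dilation_of_positive_definite.
Context {R : realType} {d : nat} {H : hilbertType R}.
Variable T : 'rV[R]_d -> H -> H.
Hypotheses (hT : C0_semigroup T) (pdT : positive_definite T).
Implicit Types (t s : 'rV[R]_d) (x : H).

Let Y := ('rV[R]_d * H)%type.

(** A function f on R^d x H stands for the vector-valued function t |-> F(t) with
    f(t, x) = <F(t), x>; the kernel section at (0, x) will be r x, and U s
    translates by s. *)
Let kfun (y z : Y) : R[i] := regular_form T (y.1 - z.1) z.2 y.2.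

Let kfun_conj y z : kfun z y = Num.conj (kfun y z).
Proof. by rewrite /kfun -opprB regular_formC. Qed.

Let Tlin t : orthant t -> linear (T t). Proof. exact: C0_linear. Qed.

(** The scalar coefficients are absorbed by the vectors, and the change of sign
    of the points turns the order of the factors into that of the kernel. *)
Let kfun_psd (e : seq (R[i] * Y)) :
  0 <= Re (\sum_(p <- e) Num.conj p.1 * \sum_(q <- e) q.1 * kfun p.2 q.2).
Proof.
pose z := fun i : 'I_(size e) => tnth (in_tuple e) i.
rewrite [leRHS](_ : _ = \sum_i \sum_j Re (regular_form T
  (- (z i).2.1 - - (z j).2.1) ((z i).1 *: (z i).2.2) ((z j).1 *: (z j).2.2))).
  exact: (pdT (fun i => - (z i).2.1) (fun i => (z i).1 *: (z i).2.2)).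
rewrite [RHS]exchange_big /= Re_sum (big_tnth _ _ e); apply: eq_bigr => i _.
rewrite mulr_sumr Re_sum (big_tnth _ _ e); apply: eq_bigr => j _.
rewrite /kfun /regular_form opprK addrC -/(z i) -/(z j).
rewrite !(linZ (Tlin (orthant_pos _))) !(linZ (Tlin (orthant_neg _))).
by rewrite innerZl innerZr; congr Re; ring.
Qed.

Let k := PDKernel kfun_conj kfun_psd.
Let H' : hilbertType R := rkhs k.

Let sigma t (y : Y) : Y := (y.1 + t, y.2).

Let kfun_sigma t y z : k (sigma t y) (sigma t z) = k y z.
Proof. by rewrite /k /= /kfun /sigma /= opprD addrACA subrr addr0. Qed.

Let U t : H' -> H' := rkhs_comp (kfun_sigma t).

Let axpyE a (f g : H') y :
  rkhs_fun (a *: f + g) y = a * rkhs_fun f y + rkhs_fun g y.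
Proof. by []. Qed.

Let UE t (f : H') y : rkhs_fun (U t f) y = rkhs_fun f (sigma t y).
Proof. by []. Qed.

Let Kv t x : H' := ker_vec [:: (1, (t, x))].

Let KvE t x y : rkhs_fun (Kv t x) y = kfun y (t, x).
Proof. by rewrite /= /ker_comb big_seq1 mul1r. Qed.

Let inner_Kv (f : H') t x : inner f (Kv t x) = rkhs_fun f (t, x).
Proof.
rewrite rkhs_innerE rkhs_inner_ker /pairing big_seq1 /=.
by rewrite (_ : Num.conj 1 = 1) ?mul1r //; exact: rmorph1.
Qed.

Let r x : H' := Kv 0 x.

Let r_linear : linear r.
Proof.
move=> a x x'; apply/val_inj/funext => y.
rewrite [RHS]axpyE [LHS]KvE !KvE /kfun /regular_form /= subr0.
by rewrite (Tlin (orthant_pos _)) innerDl innerZl.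
Qed.

Let rnorm_r x : rnorm (r x) = rnorm x.
Proof.
apply/eqP; rewrite -(@eqrXn2 _ 2) ?rnorm_ge0 //; apply/eqP.
rewrite -!Re_inner_self inner_Kv KvE /kfun /regular_form /= subrr.
by rewrite pos_part0 neg_part0 !(C0_id hT).
Qed.

Let r_bounded : bounded_operator r.
Proof.
split; first exact: r_linear.
by exists 1 => x; rewrite mul1r !rnormE rnorm_r.
Qed.

Let U_linear t : linear (U t). Proof. exact: rkhs_comp_linear. Qed.

Let U_add s t : U (s + t) =1 U s \o U t.
Proof.
by move=> f; apply/val_inj/funext => -[u x]; rewrite /= /sigma /= addrA addrAC.
Qed.

Let U_id : U 0 =1 id.
Proof. by move=> f; apply/val_inj/funext => -[u x]; rewrite /= /sigma /= addr0. Qed.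

(** U (- t) is inverse to U t and neither increases the energy. *)
Let U_energy t (f : H') : energy k (rkhs_fun (U t f)) = energy k (rkhs_fun f).
Proof.
apply/eqP; rewrite eq_le rkhs_comp_energy_le /=.
have {1}-> : f = U (- t) (U t f) by have := U_add (- t) t f; rewrite addNr U_id.
exact: rkhs_comp_energy_le.
Qed.

Let rnormH (f : H') : rnorm f ^+ 2 = energy k (rkhs_fun f).
Proof. by rewrite -Re_inner_self rkhs_innerE rkhs_inner_self. Qed.

Let rnorm_U t (f : H') : rnorm (U t f) = rnorm f.
Proof.
by apply/eqP; rewrite -(@eqrXn2 _ 2) ?rnorm_ge0 // !rnormH U_energy.
Qed.

Let U_bounded t : bounded_operator (U t).
Proof.
split; first exact: U_linear.
by exists 1 => f; rewrite mul1r !rnormE rnorm_U.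
Qed.

(** An isometry for the norm preserves the real part of the inner product, and
    being complex linear also the imaginary part. *)
Let U_inner t (f g : H') : inner (U t f) (U t g) = inner f g.
Proof.
have ReE (a b : H') : Re (inner (U t a) (U t b)) = Re (inner a b).
  have := rnormD_sqr (U t a) (U t b).
  rewrite -(linD (U_linear t)) !rnorm_U rnormD_sqr.
  by move: (Re _) (Re _) => a' b'; lra.
have := ReE ((0 +i* 1)%C *: f) g; rewrite (linZ (U_linear t)) !innerZl.
have := ReE f g; case: (inner f g) (inner (U t f) (U t g)) => [a b] [a' b'] /= ->.
by rewrite !mul0r !mul1r !sub0r => /oppr_inj ->.
Qed.

Let U_adjoint t : adjoint (U t) =1 U (- t).
Proof.
move=> f; apply: adjointE => // g; rewrite -(U_inner t).
by have := U_add t (- t) f; rewrite subrr U_id /= => <-.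
Qed.

Let U_unitary t : unitary_operator (U t).
Proof.
split=> // f; rewrite /= U_adjoint.
  by have := U_add (- t) t f; rewrite addNr U_id.
by have := U_add t (- t) f; rewrite subrr U_id.
Qed.

(** The squared distance is an expression in <phi(s) x, x>, so only the continuity
    of phi at 0 is needed. *)
Let cvg_Kv t x : U s (Kv t x) @[s --> (0 : 'rV[R]_d)] --> Kv t x.
Proof.
have FF : Filter (nbhs (0 : 'rV[R]_d)) by exact: nbhs_filter.
have distE s : rnorm (U s (Kv t x) - Kv t x) ^+ 2 =
    2 * (rnorm x ^+ 2 - Re (regular_form T s x x)).
  have KvK : rnorm (Kv t x) ^+ 2 = rnorm x ^+ 2.
    rewrite -!Re_inner_self inner_Kv KvE /kfun /regular_form /= subrr.
    by rewrite pos_part0 neg_part0 !(C0_id hT).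
  rewrite rnormD_sqr rnormN rnorm_U KvK innerNr ReN.
  have -> : inner (U s (Kv t x)) (Kv t x) = regular_form T s x x.
    by rewrite inner_Kv UE KvE /kfun /sigma /= addrAC subrr add0r.
  by ring.
have lim0 : (fun s => Re (regular_form T s x x)) @ (0 : 'rV[R]_d) --> rnorm x ^+ 2.
  have h1 : (fun s => T (pos_part s) x) @ (0 : 'rV[R]_d) --> T 0 x.
    apply: (@C0_cvg R d H T hT _ _ FF (@pos_part R d) 0 x).
    - exact: orthant0.
    - by apply: nearW => s; exact: orthant_pos.
    - exact: cvg_pos_part0.
  have h2 : (fun s => T (neg_part s) x) @ (0 : 'rV[R]_d) --> T 0 x.
    apply: (@C0_cvg R d H T hT _ _ FF (@neg_part R d) 0 x).
    - exact: orthant0.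
    - by apply: nearW => s; exact: orthant_neg.
    - exact: cvg_neg_part0.
  have := cvg_Re_form inner_hermitian FF h1 h2.
  by rewrite (C0_id hT) Re_inner_self.
apply/cvg_dist0/cvgrPdist_le => e e0.
have e2 : 0 < e ^+ 2 / 2 by rewrite divr_gt0 // exprn_gt0.
move/cvgrPdist_le: lim0 => /(_ _ e2); apply: filterS => s hs.
rewrite sub0r normrN ger0_norm ?rnorm_ge0 //.
rewrite -(@ler_pXn2r _ 2) ?nnegrE ?rnorm_ge0 ?(ltW e0) // distE.
by rewrite -ler_pdivlMl // mulrC (le_trans (ler_norm _) hs).
Qed.

Let cvg_ker e : U s (ker_vec e : H') @[s --> (0 : 'rV[R]_d)] --> (ker_vec e : H').
Proof.
have FF : Filter (nbhs (0 : 'rV[R]_d)) by exact: nbhs_filter.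
elim: e => [|[c [t x]] e IH].
  have -> : ker_vec [::] = 0 :> H'.
    by apply/val_inj/funext => y; rewrite /= /ker_comb big_nil.
  under eq_fun do rewrite (lin0 (U_linear _)).
  exact: cvg_cst.
have -> : ker_vec ((c, (t, x)) :: e) = c *: Kv t x + ker_vec e :> H'.
  apply/val_inj/funext => y.
  by rewrite [RHS]axpyE KvE /= /ker_comb big_cons.
under eq_fun do rewrite U_linear.
by apply: cvgD => //; apply: cvgZ; [exact: cvg_cst|exact: (@cvg_Kv t x)].
Qed.

(** The U s are isometries and converge on the dense set of kernel
    combinations. *)
Let cvg_U f : U s f @[s --> (0 : 'rV[R]_d)] --> f.
Proof.
have FF : Filter (nbhs (0 : 'rV[R]_d)) by exact: nbhs_filter.
apply/cvg_dist0/cvgrPdist_le => e e0.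
have e30 : 0 < e / 3 by rewrite divr_gt0.
have e3 : e / 3 + e / 3 + e / 3 = e by field.
have e32 : 0 < (e / 3) ^+ 2 by rewrite exprn_gt0.
have [c hc] := rkhs_energy_approx f e32.
have fc : rnorm (f - ker_vec c) <= e / 3.
  by rewrite -(@ler_pXn2r _ 2) ?nnegrE ?rnorm_ge0 ?(ltW e30) // rnormH ltW.
have /cvg_dist0/cvgrPdist_le := @cvg_ker c.
move=> /(_ _ e30); apply: filterS => s.
rewrite !sub0r !normrN !ger0_norm ?rnorm_ge0 // => hs.
have -> : U s f - f = U s (f - ker_vec c) + (U s (ker_vec c) - ker_vec c)
    - (f - ker_vec c).
  by rewrite (linB (U_linear s)) addrA subrK opprB addrA subrK.
apply: le_trans (rnorm_triangle _ _) _; rewrite rnormN.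
have := rnorm_triangle (U s (f - ker_vec c)) (U s (ker_vec c) - ker_vec c).
rewrite rnorm_U => h; apply: le_trans (lerD h fc) _.
apply: le_trans (lerD (lerD fc hs) (lexx (e / 3))) _.
by rewrite e3.
Qed.

Let U_continuous f : continuous (fun t => U t f).
Proof.
move=> t; have FF : Filter (nbhs t) by exact: nbhs_filter.
apply/cvg_dist0.
have E s : rnorm (U s f - U t f) = rnorm (U (s - t) f - f).
  have := U_add t (s - t) f; rewrite addrC subrK => ->.
  by rewrite -[RHS](rnorm_U t) (linB (U_linear t)).
under eq_fun do rewrite E.
have /cvg_dist0 h := @cvg_U f.
apply: (cvg_comp (fun s => s - t) (fun s => rnorm (U s f - f)) _ h).
have : (fun s => s - t) @ t --> t - t by apply: cvgB; [exact: cvg_id|exact: cvg_cst].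
by rewrite subrr.
Qed.

Lemma positive_definite_dilation : has_regular_unitary_dilation T.
Proof.
exists H', U, r; split; [by split|exact: r_bounded|].
move=> t x; apply: inner_ext => z /=.
rewrite (innerA (C0_bounded hT (orthant_neg _))) (innerA r_bounded).
rewrite inner_conj [RHS]inner_conj; congr Num.conj.
by rewrite inner_Kv UE KvE /kfun /sigma /regular_form /= add0r subr0.
Qed.

End dilation_of_positive_definite.

(** * Monotonicity from a one-sided derivative *)

Section right_monotone.
Context {R : realType}.

(** Generators are defined by right derivatives, so the usual mean value theorem
    does not apply.  The set of the t where g is above the line of
    slope - e through its value at a contains its supremum by left continuity,
    and a supremum smaller than b contradicts the hypothesis on the right. *)
Lemma right_lower_derivative_le (g : R -> R) (a b : R) : a <= b ->
  (forall t, a < t <= b -> g s @[s --> t^'-] --> g t) ->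
  (forall t, a <= t < b -> forall e, 0 < e ->
    \forall h \near 0^'+, g t - e * h <= g (t + h)) ->
  g a <= g b.
Proof.
move=> ab gl gr.
suff slack e : 0 < e -> g a - e * (b - a) <= g b.
  apply/ler_addgt0Pr => e e0; have c0 : 0 < b - a + 1 by rewrite ltr_wpDl // subr_ge0.
  rewrite -lerBlDr; apply: le_trans (slack (e / (b - a + 1)) (divr_gt0 e0 c0)).
  rewrite lerD2l lerN2 mulrAC ler_pdivrMr //.
  by rewrite ler_wpM2l ?(ltW e0) // lerDl.
move=> e0; pose S := [set t | a <= t <= b /\ g a - e * (t - a) <= g t].
have Sa : S a by split; [rewrite lexx|rewrite subrr mulr0 subr0].
have Ssup : has_sup S by split; [exists a|exists b => t [/andP[]]].
set c := sup S.
have ac : a <= c by apply: sup_upper_bound.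
have cb : c <= b by apply: ge_sup; [exists a|move=> t [/andP[]]].
have Sc : S c.
  split; first by rewrite ac.
  have [<-|ca] := eqVneq a c; first by rewrite subrr mulr0 subr0.
  rewrite leNgt; apply/negP => gc.
  have d0 : 0 < g a - e * (c - a) - g c by rewrite subr_gt0.
  have /cvgrPdist_lt/(_ _ d0) : g s @[s --> c^'-] --> g c.
    by apply: gl; rewrite lt_neqAle ca ac.
  rewrite near_withinE /= => /nbhs_ballP[r /= r0 hr].
  have [s Ss cs] := sup_adherent r0 Ssup.
  have sc : s <= c by apply: sup_upper_bound.
  have sc' : s < c.
    rewrite lt_neqAle sc andbT; apply/eqP => sE.
    by case: Ss => _; rewrite sE leNgt gc.
  have : `|g c - g s| < g a - e * (c - a) - g c.
    apply: hr => //; rewrite /ball /= gtr0_norm ?subr_gt0 //.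
    by rewrite ltrBlDl -ltrBlDr.
  rewrite ltr_distlC => /andP[_]; rewrite addrC subrK.
  case: Ss => _ /le_lt_trans h /h.
  by rewrite ltrD2l ltrN2 ltr_pM2l // ltrD2r ltNge sc.
have [<-|cNb] := eqVneq c b; first by case: Sc.
have cb' : c < b by rewrite lt_neqAle cNb.
have near_h := gr c (introT andP (conj ac cb')) e e0.
have [h [h0 hb hh]] : exists h, [/\ 0 < h, h <= b - c & g c - e * h <= g (c + h)].
  have bc0 : 0 < b - c by rewrite subr_gt0.
  near (0 : R)^'+ => h; exists h; split => //; near: h => //.
  exact: nbhs_right_le.
have : S (c + h).
  split; first by rewrite (le_trans ac) ?lerDl ?(ltW h0) //= -lerBrDl.
  apply: le_trans hh; case: Sc => _; rewrite -(lerD2r (- (e * h))).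
  by apply: le_trans; rewrite le_eqVlt; apply/orP; left; apply/eqP; ring.
by move/(sup_upper_bound Ssup); rewrite -/c gerDl leNgt h0.
Unshelve. all: by end_near. Qed.
End right_monotone.

(** * Lyapunov forms *)

Section bounded_ops.
Context {R : realType} {H : hilbertType R}.

Lemma cvg_bounded_op (H' : hilbertType R) (A : H -> H') (S : Type) (F : set_system S)
    (FF : Filter F) (f : S -> H) x :
  bounded_operator A -> f @ F --> x -> (A \o f) @ F --> A x.
Proof.
move=> [Al [M hM]] /(cvg_dist0 FF) fx; apply/(cvg_dist0 FF).
have bd s : rnorm ((A \o f) s - A x) <= M * rnorm (f s - x).
  by rewrite -lecR rmorphM /= -!rnormE -(linB Al) hM.
have lim0 : (fun s => M * rnorm (f s - x)) @ F --> (0 : R).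
  by rewrite -(mulr0 M); apply: cvgM => //; exact: cvg_cst.
apply/cvgrPdist_le => e e0; move/cvgrPdist_le: lim0 => /(_ e e0).
apply: filterS => s; rewrite !sub0r !normrN => h.
rewrite ger0_norm ?rnorm_ge0 //; apply: le_trans (bd s) _.
exact: le_trans (ler_norm _) h.
Qed.

Lemma bounded_op_ge0 (A : H -> H) : bounded_operator A ->
  exists2 M : R, 0 <= M & forall x, `|A x| <= M%:C%C * `|x|.
Proof.
move=> [_ [M hM]]; exists (Num.max 0 M); first by rewrite le_max lexx.
move=> x; apply: le_trans (hM x) _.
by rewrite ler_wpM2r // lecR le_max lexx orbT.
Qed.

(** For a semigroup S with generator A this is minus the derivative at 0 of
    h |-> B (S h u) (S h v). *)
Definition lyap (A : H -> H) (B : H -> H -> R[i]) : H -> H -> R[i] :=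
  fun u v => - (B (A u) v + B u (A v)).

Lemma lyap_hermitian A B : bounded_operator A -> hermitian_form B ->
  hermitian_form (lyap A B).
Proof.
move=> hA hB; have Al : linear A by case: hA.
split=> [v a x y|u v|].
- by rewrite /lyap Al !(form_lin hB); ring.
- by rewrite /lyap rmorphN rmorphD /= -!(form_conj hB) addrC.
have [M M0 hM] := bounded_op_ge0 hA; have [N N0 hN] := form_bound hB.
exists (N * M + N * M) => [|u v]; first by rewrite addr_ge0 // mulr_ge0.
rewrite normrN; apply: le_trans (ler_normD _ _) _.
have -> : (N * M + N * M)%:C%C * `|u| * `|v| =
    N%:C%C * (M%:C%C * `|u|) * `|v| + N%:C%C * `|u| * (M%:C%C * `|v|).
  by rewrite rmorphD !rmorphM /=; ring.
apply: lerD; [apply: le_trans (hN _ _) _|apply: le_trans (hN _ _) _].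
  by rewrite ler_wpM2r // ler_wpM2l ?ler0c.
by rewrite ler_wpM2l // mulr_ge0 ?ler0c.
Qed.

Lemma lyap_comm A1 A2 B : (forall x, A1 (A2 x) = A2 (A1 x)) ->
  lyap A1 (lyap A2 B) = lyap A2 (lyap A1 B).
Proof.
by move=> cA; apply/funext => u; apply/funext => v; rewrite /lyap !cA; ring.
Qed.

Definition deficit (S : H -> H) (B : H -> H -> R[i]) : H -> H -> R[i] :=
  fun u v => B u v - B (S u) (S v).

Lemma deficit_hermitian S B : bounded_operator S -> hermitian_form B ->
  hermitian_form (deficit S B).
Proof.
move=> hS hB; have Sl : linear S by case: hS.
split=> [v a x y|u v|].
- by rewrite /deficit Sl !(form_lin hB); ring.
- by rewrite /deficit rmorphB /= -!(form_conj hB).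
have [M M0 hM] := bounded_op_ge0 hS; have [N N0 hN] := form_bound hB.
exists (N + N * M ^+ 2) => [|u v]; first by rewrite addr_ge0 // mulr_ge0 // sqr_ge0.
apply: le_trans (ler_normB _ _) _.
have -> : (N + N * M ^+ 2)%:C%C * `|u| * `|v| =
    N%:C%C * `|u| * `|v| + N%:C%C * (M%:C%C * `|u|) * (M%:C%C * `|v|).
  by rewrite expr2 rmorphD !rmorphM /=; ring.
apply: lerD => //; apply: le_trans (hN _ _) _.
rewrite ler_pM ?mulr_ge0 ?ler0c //.
by rewrite ler_wpM2l ?ler0c.
Qed.

Lemma lyap_deficit A S B : (forall x, A (S x) = S (A x)) ->
  lyap A (deficit S B) = deficit S (lyap A B).
Proof.
move=> AS; apply/funext => u; apply/funext => v.
by rewrite /lyap /deficit !AS; ring.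
Qed.
End bounded_ops.

(** * Bounded generators *)

Section generators.
Context {R : realType} {d : nat} {H : hilbertType R}.
Variable T : 'rV[R]_d -> H -> H.
Hypotheses (hT : C0_semigroup T) (hA : has_bounded_generators T).

Local Notation S i := (marginal T i).
Local Notation G i := (generator (marginal T i)).

Lemma generator_bounded i : bounded_operator (G i).
Proof. by case: (hA i). Qed.

Lemma cvg_generator i x :
  difference_quotient (S i) x h @[h --> 0^'+] --> G i x.
Proof.
have [dom _] := hA i.
by have : generator_domain (S i) x by rewrite dom.
Qed.

Lemma difference_quotientE (A : H -> H) (S : R -> H -> H) x (h : R) :
  linear A -> A (S h x) = S h (A x) ->
  A (difference_quotient S x h) = difference_quotient S (A x) h.
Proof. by move=> Al AS; rewrite /difference_quotient (linZ Al) (linB Al) AS. Qed.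

(** A commutes with the difference quotients, hence with their limit. *)
Lemma bounded_op_generator (A : H -> H) i x : bounded_operator A ->
  (forall h y, 0 <= h -> A (S i h y) = S i h (A y)) -> A (G i x) = G i (A x).
Proof.
move=> bA AS; have Al : linear A by case: bA.
have FF : ProperFilter (0 : R)^'+ by exact: at_right_proper_filter.
have c1 := cvg_bounded_op FF bA (@cvg_generator i x).
suff c2 : (A \o difference_quotient (S i) x) @ (0 : R)^'+ --> G i (A x).
  exact: (cvg_unique (@norm_hausdorff _ H) c1 c2).
apply: cvg_trans (@cvg_generator i (A x)).
apply: near_eq_cvg; near=> h; apply/esym/difference_quotientE => //.
by apply: AS; near: h; exact: nbhs_right_ge.
Unshelve. all: by end_near. Qed.

Lemma C0_generator_comm i t x : orthant t -> T t (G i x) = G i (T t x).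
Proof.
move=> ht; apply: bounded_op_generator; first exact: (C0_bounded hT).
by move=> h y h0; rewrite marginal_C0_comm.
Qed.

Lemma generator_comm i j x : G i (G j x) = G j (G i x).
Proof.
apply: bounded_op_generator; first exact: generator_bounded.
by move=> h y h0; rewrite /marginal C0_generator_comm //; exact: orthant_axis.
Qed.

(** At each time the right derivative of B (S h u) (S h u) is minus the value of
    lyap (G i) B at S h u, hence nonpositive. *)
Lemma lyap_ge0_deficit_ge0 i B (h : R) : hermitian_form B ->
  (forall u, 0 <= Re (lyap (G i) B u u)) -> 0 <= h ->
  forall u, 0 <= Re (deficit (S i h) B u u).
Proof.
move=> hB lB h0 u.
rewrite /deficit ReB.
pose g s := - Re (B (S i s u) (S i s u)).
suff : g 0 <= g h by rewrite /g (marginal0 hT) lerN2 subr_ge0.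
apply: right_lower_derivative_le => // [t /andP[t0 th]|t /andP[t0 th] e e0].
  apply: cvgN.
  have FF : Filter t^'- by exact: at_left_proper_filter.
  have St : S i s u @[s --> t^'-] --> S i t u.
    apply: cvg_marginal => //.
    - exact: ltW (le_lt_trans _ t0).
    - exact: nbhs_left_ge.
    - exact: cvg_within.
  exact: (cvg_Re_form hB FF St St).
pose w := S i t u; pose q s := difference_quotient (S i) w s.
have FF : Filter (0 : R)^'+ by exact: at_right_proper_filter.
have gE s : 0 < s -> g (t + s) = g t -
    s * (Re (B (q s) w) + Re (B w (q s)) + s * Re (B (q s) (q s))).
  move=> s0; have Ss : S i (t + s) u = w + s%:C%C *: q s.
    rewrite addrC marginalD ?(ltW s0) // /q /difference_quotient scalerA -rmorphM.
    by rewrite divff ?gt_eqF // scale1r addrC subrK.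
  rewrite /g Ss -/w.
  have Js : Num.conj s%:C%C = s%:C%C by exact: conjc_real.
  rewrite (formDl hB) !(formDr hB) !(formZl hB) !(formZr hB) Js !ReD !ReZ; ring.
have qw : q s @[s --> 0^'+] --> G i w by exact: cvg_generator.
have cw : (fun=> w) @ (0 : R)^'+ --> w by exact: cvg_cst.
have lim : Re (B (q s) w) + Re (B w (q s)) + s * Re (B (q s) (q s)) @[s --> 0^'+] -->
    - Re (lyap (G i) B w w).
  rewrite /lyap ReN opprK ReD.
  have -> : Re (B (G i w) w) + Re (B w (G i w)) = Re (B (G i w) w)
      + Re (B w (G i w)) + 0 * Re (B (G i w) (G i w)) by rewrite mul0r addr0.
  apply: cvgD; first by apply: cvgD; exact: cvg_Re_form.
  apply: cvgM; last exact: cvg_Re_form.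
  exact: cvg_within.
move/cvgrPdist_le: lim => /(_ e e0) near_e.
near=> s; have s0 : 0 < s by near: s; exact: nbhs_right_gt.
rewrite gE // lerD2l lerN2 [leRHS]mulrC ler_pM2l //.
have : `|- Re (lyap (G i) B w w) - (Re (B (q s) w) + Re (B w (q s)) +
    s * Re (B (q s) (q s)))| <= e by near: s.
rewrite ler_distlC => /andP[_ h1]; apply: le_trans h1 _.
by rewrite gerDr oppr_le0 lB.
Unshelve. all: by end_near. Qed.
End generators.

(** * Complete dissipativity implies positive definiteness *)

Section dissipative_positive_definite.
Context {R : realType} {d : nat} {H : hilbertType R}.
Variable T : 'rV[R]_d -> H -> H.
Hypotheses (hT : C0_semigroup T) (hA : has_bounded_generators T).
Implicit Types (K L : seq 'I_d) (B : H -> H -> R[i]).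

Local Notation S i := (marginal T i).
Local Notation G i := (generator (marginal T i)).

Definition lyap_gen K B := foldr (fun i => lyap (G i)) B K.

Lemma lyap_gen_hermitian K B : hermitian_form B -> hermitian_form (lyap_gen K B).
Proof.
by move=> hB; elim: K => //= i K; apply: lyap_hermitian; exact: generator_bounded.
Qed.

Lemma lyap_gen_deficit K i (c : R) B : 0 <= c ->
  lyap_gen K (deficit (S i c) B) = deficit (S i c) (lyap_gen K B).
Proof.
move=> c0; elim: K => //= j K ->; apply: lyap_deficit => x.
by rewrite /marginal C0_generator_comm //; exact: orthant_axis.
Qed.

(** For B the inner product, its nonnegativity is positive definiteness; other
    forms B come up in the induction. *)
Definition regular_sum B n (t : 'I_n -> 'rV[R]_d) (x : 'I_n -> H) : R :=
  \sum_j \sum_k Re (B (T (pos_part (t j - t k)) (x j)) (T (neg_part (t j - t k)) (x k))).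

Let ax i : 'rV[R]_d := delta_mx 0 i.

Let pos_part_axis (u : 'rV[R]_d) i (c : R) : 0 <= c -> c <= u 0 i ->
  pos_part (u - c *: ax i) + c *: ax i = pos_part u /\
  neg_part (u - c *: ax i) = neg_part u.
Proof.
move=> c0 cu; split; apply/rowP => j; rewrite !mxE eqxx /=.
  have [->|ji] := eqVneq j i; last by rewrite mulr0 subr0 addr0.
  by rewrite mulr1 !max_l ?subrK ?subr_ge0 // (le_trans c0).
have [->|ji] := eqVneq j i; last by rewrite mulr0 subr0.
by rewrite mulr1 !max_r // oppr_le0 ?subr_ge0 // (le_trans c0).
Qed.

Let regular_sum_const B n (t : 'I_n -> 'rV[R]_d) x : hermitian_form B ->
  (forall u, 0 <= Re (B u u)) -> (forall i j k, t j 0 i = t k 0 i) ->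
  0 <= regular_sum B t x.
Proof.
move=> hB B0 tc; have -> : regular_sum B t x = Re (B (\sum_j x j) (\sum_j x j)).
  rewrite (form_suml hB) Re_sum; apply: eq_bigr => j _.
  rewrite (form_sumr hB) Re_sum; apply: eq_bigr => k _.
  have -> : t j - t k = 0 by apply/rowP => i; rewrite !mxE (tc i j k) subrr.
  by rewrite pos_part0 neg_part0 !(C0_id hT).
exact: B0.
Qed.

(** The points with largest i-th coordinate b are pushed down to the next value
    a, and T_i(b - a) is applied to their vectors.  The terms for pairs with
    at most one such point do not change; for pairs of such points the form B is
    replaced by its value after T_i(b - a), and the second sum accounts for the
    difference. *)
Let regular_sum_collapse B n (t : 'I_n -> 'rV[R]_d) x i (b a : R) :
  hermitian_form B -> a <= b -> (forall j, t j 0 i = b \/ t j 0 i <= a) ->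
  regular_sum B t x =
  regular_sum B (fun j => if t j 0 i == b then t j - (b - a) *: ax i else t j)
    (fun j => if t j 0 i == b then S i (b - a) (x j) else x j)
  + regular_sum (deficit (S i (b - a)) B) (fun j => t j - t j 0 i *: ax i)
    (fun j => if t j 0 i == b then x j else 0).
Proof.
move=> hB ab tb; have c0 : 0 <= b - a by rewrite subr_ge0.
have oc : orthant ((b - a) *: ax i) by exact: orthant_axis.
have hD : hermitian_form (deficit (S i (b - a)) B).
  by apply: deficit_hermitian => //; exact: marginal_bounded.
have TL u : orthant u -> linear (T u) by exact: C0_linear.
have Tp u y : T (pos_part u) (S i (b - a) y) = T (pos_part u + (b - a) *: ax i) y.
  by rewrite (C0_add hT) //; exact: orthant_pos.
have Tn u y : T (neg_part u) (S i (b - a) y) = T (neg_part u + (b - a) *: ax i) y.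
  by rewrite (C0_add hT) //; exact: orthant_neg.
rewrite /regular_sum -big_split; apply: eq_bigr => j _ /=.
rewrite -big_split; apply: eq_bigr => k _ /=.
have [jb|jb] := eqVneq (t j 0 i) b; have [kb|kb] := eqVneq (t k 0 i) b.
- have -> : t j - (b - a) *: ax i - (t k - (b - a) *: ax i) = t j - t k.
    by rewrite opprB addrA subrK.
  have -> : t j - t j 0 i *: ax i - (t k - t k 0 i *: ax i) = t j - t k.
    by rewrite jb kb opprB addrA subrK.
  rewrite -!(marginal_C0_comm hT) //; try exact: orthant_pos; try exact: orthant_neg.
  by rewrite /deficit ReB addrC subrK.
- rewrite (lin0 (TL _ (orthant_neg _))) (form0r hD) /= addr0.
  have ck : b - a <= (t j - t k) 0 i.
    rewrite !mxE jb lerD2l lerN2; case: (tb k) => // kb'.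
    by rewrite kb' eqxx in kb.
  have [e1 e2] := pos_part_axis c0 ck.
  by rewrite Tp [t j - _ - t k]addrAC e1 e2.
- rewrite (lin0 (TL _ (orthant_pos _))) (form0l hD) /= addr0.
  have ck : b - a <= (t k - t j) 0 i.
    rewrite !mxE kb lerD2l lerN2; case: (tb j) => // jb'.
    by rewrite jb' eqxx in jb.
  have [e1 e2] := pos_part_axis c0 ck.
  have -> : t j - (t k - (b - a) *: ax i) = - (t k - t j - (b - a) *: ax i).
    by rewrite !opprB addrCA.
  by rewrite Tn pos_partN neg_partN e1 e2 -pos_partN -neg_partN opprB.
by rewrite (lin0 (TL _ (orthant_neg _))) (form0r hD) /= addr0.
Qed.

(** Outer induction on the coordinates in which the points may differ, inner
    induction on the list s of values of the coordinate i, in decreasing order.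
    The list L of coordinates shrinks for the difference form, and the list s
    for the collapsed points. *)
Lemma regular_sum_ge0 L B n (t : 'I_n -> 'rV[R]_d) (x : 'I_n -> H) :
  hermitian_form B ->
  (forall K, subseq K L -> forall u, 0 <= Re (lyap_gen K B u u)) ->
  (forall i, i \notin L -> forall j k, t j 0 i = t k 0 i) ->
  0 <= regular_sum B t x.
Proof.
elim: L B t x => [|i L IHL] B t x hB B0 tc.
  apply: regular_sum_const => // [u|i]; last exact: tc.
  exact: (B0 [::]).
have B0L K : subseq K L -> forall u, 0 <= Re (lyap_gen K B u u).
  by move=> KL; apply: B0; exact: subseq_trans KL (subseq_cons _ _).
have [s ts ss] : exists2 s, (forall j, t j 0 i \in s) & sorted >=%R s.
  exists (sort >=%R [seq t j 0 i | j <- enum 'I_n]) => [j|].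
    by rewrite mem_sort; apply: map_f; rewrite mem_enum.
  by apply: sort_sorted => a b; exact: le_total.
elim: s t x ts tc ss => [|b [|a s] IHs] t x ts tc ss.
- by rewrite /regular_sum big1 // => j; have := ts j.
- apply: IHL => // i' iL j k; have [->|ii'] := eqVneq i' i.
    by have := ts j; have := ts k; rewrite !inE => /eqP -> /eqP ->.
  by apply: tc; rewrite inE negb_or ii'.
have ba : a <= b by case/andP: ss.
have sa c : c \in a :: s -> c <= a.
  rewrite inE => /orP[/eqP -> //|cs].
  have : path >=%R a s by case/andP: ss.
  rewrite path_sortedE; last by move=> u v w h1 h2; exact: le_trans h2 h1.
  by case/andP => /allP/(_ _ cs).
have tba j : t j 0 i = b \/ t j 0 i <= a.
  have := ts j; rewrite inE => /orP[/eqP|]; first by left.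
  by move=> /sa; right.
rewrite (regular_sum_collapse x hB ba tba) addr_ge0 //.
  apply: IHs => [j|i' iL j k|]; last by case/andP: ss.
    have := ts j; rewrite inE; case: eqVneq => [tb _|_ //].
    by rewrite !mxE !eqxx mulr1 tb opprB addrC subrK mem_head.
  have ii' : (i' == i) = false by apply: negbTE; move: iL; rewrite inE negb_or => /andP[].
  have e l : (if t l 0 i == b then t l - (b - a) *: ax i else t l) 0 i' = t l 0 i'.
    by case: ifP => // _; rewrite !mxE ii' mulr0 subr0.
  by rewrite !e; exact: tc.
apply: IHL => [|K KL u|i' iL j k].
- apply: deficit_hermitian => //; apply: (marginal_bounded hT); by rewrite subr_ge0.
- rewrite lyap_gen_deficit ?subr_ge0 //.
  apply: (lyap_ge0_deficit_ge0 hT hA); rewrite ?subr_ge0 //.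
    exact: lyap_gen_hermitian.
  by move=> v; apply: (B0 (i :: K)); rewrite /= eqxx.
rewrite !mxE eqxx; have [->|ii'] := eqVneq i' i; first by rewrite !mulr1 !subrr.
by rewrite !mulr0 !subr0; apply: tc; rewrite inE negb_or ii'.
Qed.

End dissipative_positive_definite.

(** * A regular dilation implies complete dissipativity *)

Section dilation_dissipative.
Context {R : realType} {d : nat} {H : hilbertType R}.
Variable T : 'rV[R]_d -> H -> H.
Hypotheses (hT : C0_semigroup T) (hA : has_bounded_generators T).
Implicit Types (e : seq ('I_d * R)) (B : H -> H -> R[i]).

Local Notation S i := (marginal T i).
Local Notation G i := (generator (marginal T i)).

Definition increment i (h : R) (x : H) : H := S i h x - x.

Lemma increment_bounded i (h : R) : 0 <= h -> bounded_operator (increment i h).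
Proof.
move=> h0; have hS := marginal_bounded hT i h0.
have [M M0 hM] := bounded_op_ge0 hS; have Sl : linear (S i h) by case: hS.
split=> [a x y|].
  by rewrite /increment Sl scalerBr addrACA opprD.
exists (M + 1) => x; apply: le_trans (ler_normB _ _) _.
by rewrite rmorphD mulrDl mul1r lerD.
Qed.

Definition lyap_increments e B :=
  foldr (fun p : 'I_d * R => lyap (increment p.1 p.2)) B e.

Let positive_steps e := all (fun p : 'I_d * R => 0 < p.2) e.

Lemma lyap_increments_hermitian e B : positive_steps e -> hermitian_form B ->
  hermitian_form (lyap_increments e B).
Proof.
move=> + hB; elim: e => //= p e IH /andP[p0 e0]; apply: lyap_hermitian; last exact: IH.
exact/increment_bounded/ltW.
Qed.

(** The difference quotient is the increment divided by h > 0. *)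
Let lyap_ge0_of_increments i B : hermitian_form B ->
  (forall h, 0 < h -> forall x, 0 <= Re (lyap (increment i h) B x x)) ->
  forall x, 0 <= Re (lyap (G i) B x x).
Proof.
move=> hB h0 x.
have FF : Filter (0 : R)^'+ by exact: at_right_proper_filter.
pose q h := difference_quotient (S i) x h.
have qG : q h @[h --> (0 : R)^'+] --> G i x by exact: cvg_generator.
have cx : (fun=> x) @ (0 : R)^'+ --> x by exact: cvg_cst.
have lim : - (Re (B (q h) x) + Re (B x (q h))) @[h --> (0 : R)^'+] -->
    Re (lyap (G i) B x x).
  by rewrite /lyap ReN ReD; apply: cvgN; apply: cvgD; exact: cvg_Re_form.
apply: (cvgr_to_ge lim); near=> h.
have hp : 0 < h by near: h; exact: nbhs_right_gt.
have -> : - (Re (B (q h) x) + Re (B x (q h))) =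
    h^-1 * Re (lyap (increment i h) B x x).
  have Jh : Num.conj (h^-1)%:C%C = (h^-1)%:C%C :> R[i] by exact: conjc_real.
  rewrite /q /difference_quotient (formZl hB) (formZr hB) Jh !ReZ -mulrDr -ReD.
  by rewrite -mulrN -ReN.
by rewrite mulr_ge0 ?invr_ge0 ?(ltW hp) // h0.
Unshelve. all: by end_near. Qed.

Let increment_generator_comm i j (h : R) x : 0 <= h ->
  increment i h (G j x) = G j (increment i h x).
Proof.
move=> h0; have Gl : linear (G j) by case: (generator_bounded hA j).
rewrite /increment (linB Gl) /marginal (C0_generator_comm hT hA) //.
exact: orthant_axis.
Qed.

(** The steps are sent to 0 one after the other, so that only the continuity of
    a fixed bounded form is needed each time; commutation brings the increment
    whose step varies to the outside. *)
Lemma lyap_gen_ge0_of_increments (s : seq 'I_d) B : hermitian_form B ->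
  (forall e, map fst e = s -> positive_steps e ->
     forall x, 0 <= Re (lyap_increments e B x x)) ->
  forall x, 0 <= Re (lyap_gen T s B x x).
Proof.
elim: s B => [|i s IH] B hB h0 x; first exact: (h0 [::]).
have lyapG K B' : lyap (G i) (lyap_gen T K B') = lyap_gen T K (lyap (G i) B').
  elim: K => //= j K <-; apply: lyap_comm => y; exact: generator_comm.
have lyapE e B' : positive_steps e ->
    lyap_increments e (lyap (G i) B') = lyap (G i) (lyap_increments e B').
  elim: e => //= p e IHe /andP[p0 e0]; rewrite IHe //; apply: lyap_comm => y.
  exact/increment_generator_comm/ltW.
rewrite /= lyapG; apply: IH => [|e es e0 y].
  by apply: lyap_hermitian => //; exact: generator_bounded.
rewrite lyapE //; apply: lyap_ge0_of_increments => [|h hp z].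
  exact: lyap_increments_hermitian.
by apply: (h0 ((i, h) :: e)); rewrite /= ?es ?hp.
Qed.

Section dilated.
Variables (H' : hilbertType R) (U : 'rV[R]_d -> H' -> H') (r : H -> H').
Hypothesis hd : regular_unitary_dilation T U r.

Let hU : unitary_representation U. Proof. by case: hd. Qed.
Let Ulin t : linear (U t). Proof. by case: (urep_unitary hU t) => -[]. Qed.
Let axis (p : 'I_d * R) : 'rV[R]_d := p.2 *: delta_mx 0 p.1.

Let V e : H' -> H' := foldr (fun p g f => g (f - U (axis p) f)) id e.

Let V_linear e : linear (V e).
Proof.
elim: e => //= p e IH a f g; rewrite Ulin -IH; congr (V e _).
by rewrite scalerBr addrACA opprD.
Qed.

Let V_comm e t f : V e (U t f) = U t (V e f).
Proof.
elim: e f => //= p e IH f; rewrite -IH (linB (Ulin t)); congr (V e (_ - _)).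
by have := urep_add hU t (axis p) f; rewrite addrC (urep_add hU) /= => ->.
Qed.

(** For an isometry W the form - <(W - 1) f, g> - <f, (W - 1) g> is
    <(1 - W) f, (1 - W) g>. *)
Let V_step e p f g :
  inner (V (p :: e) f) (V (p :: e) g) =
  - (inner (V e (U (axis p) f - f)) (V e g)
     + inner (V e f) (V e (U (axis p) g - g))).
Proof.
have Vl := V_linear e; rewrite /= !(linB Vl) !V_comm.
rewrite !innerDl !innerDr !innerNl !innerNr.
by rewrite (unitary_rep_isometry hU (axis p)) subrr (urep_id hU); ring.
Qed.

(** The vectors have to be general T a x and T b y for the induction, which adds
    a step to a or to b.  Disjoint supports of a and b make them the positive and
    negative part of a - b, so that the regularity of the dilation applies. *)
Lemma lyap_increments_dilation e (a b : 'rV[R]_d) x y :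
  positive_steps e -> uniq (map fst e) -> orthant a -> orthant b ->
  (forall i, a 0 i = 0 \/ b 0 i = 0) ->
  (forall i, i \in map fst e -> a 0 i = 0 /\ b 0 i = 0) ->
  lyap_increments e inner (T a x) (T b y) =
  inner (V e (U a (r x))) (V e (U b (r y))).
Proof.
elim: e a b => [|p e IH] a b.
  move=> _ _ ha hb ab _; rewrite unitary_rep_isometry //.
  rewrite -(dilation_formE hT hd) /regular_form pos_part_disjoint //.
  rewrite -pos_partN opprB pos_part_disjoint // => i.
  by case: (ab i); [right|left].
move=> /= /andP[p0 e0] /andP[pe ue] ha hb ab abe.
have hF := lyap_increments_hermitian e0 inner_hermitian.
have op : orthant (axis p) by apply: orthant_axis; exact: ltW.
have [ap bp] : a 0 p.1 = 0 /\ b 0 p.1 = 0 by apply: abe; rewrite mem_head.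
have shift (c : 'rV[R]_d) z : orthant c ->
    increment p.1 p.2 (T c z) = T (axis p + c) z - T c z.
  by move=> hc; rewrite (C0_add hT).
have ax_eq0 i : i != p.1 -> axis p 0 i = 0.
  by move=> ip; rewrite !mxE (negPf ip) mulr0.
have abe' i : i \in map fst e -> a 0 i = 0 /\ b 0 i = 0.
  by move=> ie; apply: abe; rewrite inE ie orbT.
have ne i : i \in map fst e -> i != p.1.
  by move=> ie; apply: contraNneq pe => <-.
have oa : orthant (axis p + a) by exact: orthantD.
have ob : orthant (axis p + b) by exact: orthantD.
have disa i : (axis p + a) 0 i = 0 \/ b 0 i = 0.
  rewrite mxE; have [->|ip] := eqVneq i p.1; first by right.
  by rewrite ax_eq0 // add0r; exact: ab.
have disb i : a 0 i = 0 \/ (axis p + b) 0 i = 0.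
  rewrite mxE; have [->|ip] := eqVneq i p.1; first by left.
  by rewrite ax_eq0 // add0r; exact: ab.
have offa i : i \in map fst e -> (axis p + a) 0 i = 0 /\ b 0 i = 0.
  by move=> ie; rewrite mxE ax_eq0 ?ne // add0r; exact: abe'.
have offb i : i \in map fst e -> a 0 i = 0 /\ (axis p + b) 0 i = 0.
  by move=> ie; rewrite mxE ax_eq0 ?ne // add0r; exact: abe'.
rewrite /lyap -/(lyap_increments e inner) !shift // (formBl hF) (formBr hF).
rewrite (IH (axis p + a) b) // (IH a b) // (IH a (axis p + b)) //.
rewrite !(urep_add hU) /= -[RHS]/(inner (V (p :: e) _) (V (p :: e) _)) V_step.
by rewrite !(linB (V_linear e)) innerDl innerNl innerDr innerNr.
Qed.
End dilated.

Lemma dilation_lyap_gen_ge0 (s : seq 'I_d) :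
  has_regular_unitary_dilation T -> uniq s ->
  forall x, 0 <= Re (lyap_gen T s inner x x).
Proof.
move=> [H' [U [r hd]]] us; apply: lyap_gen_ge0_of_increments.
  exact: inner_hermitian.
move=> e es e0 x; rewrite -{1 2}(C0_id hT x).
rewrite (lyap_increments_dilation hd) ?es //; try exact: orthant0.
- by rewrite Re_inner_self exprn_ge0 // rnorm_ge0.
- by move=> i; left; rewrite mxE.
- by move=> i _; rewrite mxE.
Qed.
End dilation_dissipative.

(** * The dissipation operators *)

Section dissipation_operator.
Context {R : realType} {d : nat} {H : hilbertType R}.
Variable T : 'rV[R]_d -> H -> H.
Hypotheses (hT : C0_semigroup T) (hA : has_bounded_generators T).
Implicit Types (C K : {set 'I_d}) (B : H -> H -> R[i]).

Let N i : H -> H := fun x => - generator (marginal T i) x.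
Let P C : H -> H := neg_generator_prod T C.

Let N_linear i : linear (N i).
Proof.
have Gl : linear (generator (marginal T i)) by case: (generator_bounded hA i).
by move=> a x y; rewrite /N Gl opprD scalerN.
Qed.

Let N_bounded i : bounded_operator (N i).
Proof.
split; first exact: N_linear.
have [M _ hM] := bounded_op_ge0 (generator_bounded hA i).
by exists M => x; rewrite /N normrN.
Qed.

Let N_comm i j x : N i (N j x) = N j (N i x).
Proof.
have Gl k : linear (generator (marginal T k)) by case: (generator_bounded hA k).
by rewrite /N !(linN (Gl _)) (generator_comm hT hA).
Qed.

Let PE C x : P C x = foldr N x (enum C).
Proof.
have <- : [seq i <- index_enum 'I_d | i \in C] = enum C by rewrite [index_enum _]unlock.
rewrite /P /neg_generator_prod -big_filter.
by elim: [seq i <- _ | _] => [|i s IH]; rewrite ?big_nil ?big_cons //= IH.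
Qed.

Let foldr_comm i s x : foldr N (N i x) s = N i (foldr N x s).
Proof. by elim: s => //= j s ->; exact: N_comm. Qed.

Let foldr_rem i s x : i \in s -> foldr N x s = N i (foldr N x (rem i s)).
Proof.
elim: s => //= j s IH; rewrite inE; have [-> //|ji] := eqVneq j i.
by move=> /= /IH ->; exact: N_comm.
Qed.

Let P_setU1 i C x : i \notin C -> P (i |: C) x = P C (N i x).
Proof.
move=> iC; rewrite !PE foldr_comm (foldr_rem x (i := i)); last first.
  by rewrite mem_enum finset.setU11.
congr (N i (foldr _ _ _)); rewrite rem_filter ?enum_uniq // /enum_mem -filter_predI.
apply: eq_filter => j /=; rewrite !inE; have [->|] //= := eqVneq j i.
by rewrite (negPf iC).
Qed.

Let P_bounded C : bounded_operator (P C).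
Proof.
have -> : P C = fun x => foldr N x (enum C) by apply/funext => x; exact: PE.
elim: (enum C) => [|i s [sl [M' hM']]] /=.
  by split=> //; exists 1 => x; rewrite mul1r.
split=> [a x y|]; first by rewrite sl N_linear.
have [M M0 hM] := bounded_op_ge0 (N_bounded i).
exists (M * M') => x; apply: le_trans (hM _) _.
by rewrite rmorphM -mulrA ler_wpM2l // ler0c.
Qed.

(** The index set of the sum that defines a dissipation operator. *)
Let splits (K : {set 'I_d}) (C : {set 'I_d} * {set 'I_d}) :=
  [disjoint C.1 & C.2] && (C.1 :|: C.2 == K).

Let splits_setC K Q : splits K Q = splits K (Q.2, Q.1).
Proof. by rewrite /splits /= disjoint_sym finset.setUC. Qed.

Let splits_setU1 K i (Q : {set 'I_d} * {set 'I_d}) : i \notin K ->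
  splits (i |: K) (i |: Q.1, Q.2) && ((i |: Q.1) :\ i == Q.1) = splits K Q.
Proof.
move=> iK; rewrite /splits /=; apply/idP/idP.
  case/andP => /andP[dis /eqP eU] /eqP e1; apply/andP; split.
    by apply: disjointWl dis; exact: finset.subsetUr.
  have i1 : i \notin Q.1 by rewrite -e1 !inE eqxx.
  have i2 : i \notin Q.2 by rewrite (disjointFr dis) // finset.setU11.
  apply/eqP/setP => j; have := congr1 (fun A : {set 'I_d} => j \in A) eU.
  rewrite !inE; have [->|//] := eqVneq j i.
  by rewrite (negPf i1) (negPf i2) (negPf iK).
case/andP => dis /eqP eU; have : i \notin Q.1 :|: Q.2 by rewrite eU.
rewrite inE negb_or => /andP[i1 i2].
rewrite -finset.setUA eU eqxx andbT finset.setU1K // eqxx andbT.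
rewrite disjoint_subset; apply/fintype.subsetP => j; rewrite !inE => /orP[/eqP -> //|jA].
by rewrite (disjointFr dis).
Qed.

(** A splitting of i |: K puts i into exactly one of its two sets. *)
Let sum_splits_setU1 K i (F : {set 'I_d} * {set 'I_d} -> R[i]) : i \notin K ->
  \sum_(Q | splits (i |: K) Q) F Q =
  \sum_(Q | splits K Q) (F (i |: Q.1, Q.2) + F (Q.1, i |: Q.2)).
Proof.
move=> iK.
rewrite big_split (bigID (fun Q : {set 'I_d} * {set 'I_d} => i \in Q.1)) /=.
congr (_ + _).
  rewrite (reindex_onto (fun Q => (i |: Q.1, Q.2)) (fun Q => (Q.1 :\ i, Q.2))).
    by apply: eq_bigl => -[A D] /=; rewrite -(splits_setU1 _ iK) /= finset.setU11 andbT
      xpair_eqE eqxx andbT.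
  by move=> [A D] /= /andP[_ iA]; rewrite finset.setD1K.
rewrite (reindex_onto (fun Q => (Q.1, i |: Q.2)) (fun Q => (Q.1, Q.2 :\ i))).
  apply: eq_bigl => -[A D] /=.
  rewrite [RHS]splits_setC -(splits_setU1 _ iK) /= [X in _ = X && _]splits_setC /=.
  rewrite xpair_eqE eqxx /=; case: (boolP (splits _ _)) => //= /andP[/= dis _].
  by rewrite (disjointFl dis) ?finset.setU11.
move=> [A D] /= /andP[/andP[_ /eqP eU] iA]; rewrite finset.setD1K //.
by have := finset.setU11 i K; rewrite -eU inE (negPf iA).
Qed.

(** Each factor lyap lets its generator act on the first or on the second
    argument, which is the choice of a splitting. *)
Lemma lyap_gen_expand (s : seq 'I_d) B u v : hermitian_form B -> uniq s ->
  lyap_gen T s B u v =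
  \sum_(Q | splits [set i in s] Q) B (P Q.2 u) (P Q.1 v).
Proof.
move=> hB; elim: s u v => [|i s IH] u v us.
  rewrite (big_pred1 (finset.set0, finset.set0)) /=; first by rewrite !PE enum_set0.
  move=> [A D]; rewrite /splits /= xpair_eqE.
  rewrite (_ : [set i in [::]] = finset.set0); last first.
    by apply/setP => i; rewrite !inE.
  rewrite finset.setU_eq0 -finset.setI_eq0; apply/idP/idP => [/andP[] //|h].
  by have /andP[/eqP eA _] := h; rewrite h andbT eA finset.set0I eqxx.
have /andP[is_ us'] := us.
have iK : i \notin [set j in s] by rewrite inE.
have -> : [set j in i :: s] = i |: [set j in s] by apply/setP => j; rewrite !inE.
rewrite sum_splits_setU1 //=.
have hF := lyap_gen_hermitian hA s hB.
rewrite /lyap opprD -(formNl hF) -(formNr hF) !IH // -big_split /=.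
apply: eq_bigr => -[A D] /andP[/= dis /eqP eU].
have : i \notin A :|: D by rewrite eU.
by rewrite inE negb_or => /andP[iA iD]; rewrite !P_setU1 // addrC.
Qed.

Lemma inner_dissipation_operator K x :
  inner (dissipation_operator T K x) x = 2 ^- #|K| * lyap_gen T (enum K) inner x x.
Proof.
rewrite /dissipation_operator innerZl; congr (_ * _).
rewrite (lyap_gen_expand _ _ inner_hermitian (enum_uniq _)).
rewrite (form_suml inner_hermitian).
have -> : [set i in enum K] = K by apply/setP => i; rewrite inE mem_enum.
apply: eq_bigr => C _.
by rewrite inner_conj (innerA (P_bounded C.1)) -inner_conj.
Qed.

Lemma positive_dissipationP K : positive_operator (dissipation_operator T K) <->
  forall x, 0 <= Re (lyap_gen T (enum K) inner x x).
Proof.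
have hF := lyap_gen_hermitian hA (enum K) inner_hermitian.
have p2 : (0 : R[i]) < 2 ^- #|K| by rewrite invr_gt0 exprn_gt0.
split=> h x.
  by have := h x; rewrite inner_dissipation_operator pmulr_rge0 // -(form_real hF) ler0c.
by rewrite inner_dissipation_operator pmulr_rge0 // -(form_real hF) ler0c.
Qed.

Lemma completely_dissipative_positive_definite :
  completely_dissipative T -> positive_definite T.
Proof.
move=> cd n t x; apply: (regular_sum_ge0 hT hA (L := enum 'I_d)).
- exact: inner_hermitian.
- move=> K /(subseq_uniqP (enum_uniq _)) KE.
  have -> : K = enum [set i in K].
    rewrite [LHS]KE enumT /enum_mem; apply: eq_filter => i /=.
    by rewrite !inE.
  exact/positive_dissipationP.
- by move=> i; rewrite mem_enum.
Qed.

Lemma dilation_completely_dissipative :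
  has_regular_unitary_dilation T -> completely_dissipative T.
Proof.
move=> hd K; apply/positive_dissipationP.
exact: (dilation_lyap_gen_ge0 hT hA hd (enum_uniq _)).
Qed.
End dissipation_operator.

(** * Limits along nets *)

Section nets.
Context {R : realType}.
Context {I : Type} (le : I -> I -> Prop) (hle : directed le).

Lemma net_tails_proper : ProperFilter (net_tails le).
Proof.
case: hle => -[a0] refl trans ub.
apply: filter_from_proper; last by move=> a _; exists a; exact: refl.
apply: filter_from_filter; first by exists a0.
move=> a b _ _; have [c [ac bc]] := ub a b; exists c => // x cx.
by split; [exact: trans ac cx|exact: trans bc cx].
Qed.

Lemma sup_on_cvg0P (E : Type) (L : set E) (f : I -> E -> \bar R) :
  sup_on L (f a) @[a --> net_tails le] --> 0%E <->
  forall e : R, 0 < e ->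
    \forall a \near net_tails le, forall t, L t -> (f a t <= e%:E)%E.
Proof.
have FF := net_tails_proper.
have ge0 a : (0 <= sup_on L (f a))%E by apply: ereal_sup_ubound; left.
split=> [h e e0|h].
  have nb : nbhs (0 : R)%:E [set y : \bar R | (y <= e%:E)%E].
    change (nbhs (0 : R) (fun r : R => (r%:E <= e%:E)%E)).
    apply/nbhs_ballP; exists e => // r /=; rewrite /ball /= sub0r normrN lee_fin.
    by move=> /ltW; apply: le_trans; exact: ler_norm.
  have near_h : \forall a \near net_tails le, (sup_on L (f a) <= e%:E)%E := h _ nb.
  apply: filterS near_h => a ha t Lt; apply: le_trans ha.
  by apply: ereal_sup_ubound; right; exists t.
move=> A nA; have /nbhs_ballP[e /= e0 hA] : nbhs (0 : R) (fun r : R => A r%:E) by [].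
have e20 : 0 < e / 2 by rewrite divr_gt0.
change (\forall a \near net_tails le, A (sup_on L (f a))).
apply: filterS (h _ e20) => a ha.
have : (sup_on L (f a) <= (e / 2)%:E)%E.
  by apply: ge_ereal_sup => _ [->|[t Lt <-]]; [rewrite lee_fin ltW|exact: ha].
have := ge0 a; rewrite /=; case: (sup_on L (f a)) => [r| |] //.
rewrite !lee_fin => r0 re; apply: hA; rewrite /ball /= sub0r normrN ger0_norm //.
by apply: le_lt_trans re _; rewrite ltr_pdivrMr // ltr_pMr // ltr1n.
Qed.
End nets.

Section limits_of_dilations.
Context {R : realType} {d : nat} {H : hilbertType R}.
Variable T : 'rV[R]_d -> H -> H.
Hypothesis hT : C0_semigroup T.
Context {I : Type} (le : I -> I -> Prop) (hle : directed le).
Variable Ta : I -> 'rV[R]_d -> H -> H.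

Lemma cvg_positive_definite :
  (forall a, positive_definite (Ta a)) ->
  (forall t x, orthant t -> Ta a t x @[a --> net_tails le] --> T t x) ->
  positive_definite T.
Proof.
move=> pd lim n t x; have FF := net_tails_proper hle.
apply: (@cvgr_to_ge _ _ FF _ (fun a => \sum_i \sum_j
  Re (regular_form (Ta a) (t i - t j) (x i) (x j)))); last first.
  by apply: nearW => a; exact: pd.
apply: cvg_big => [|i _]; first exact: add_continuous.
apply: cvg_big => [|j _]; first exact: add_continuous.
by apply: (cvg_Re_form inner_hermitian); apply: lim;
  [exact: orthant_pos|exact: orthant_neg].
Qed.

(** The vector x is scaled into the unit ball, where the operator norm bounds the
    values. *)
Lemma cvg_strong_of_norm :
  (forall a, C0_semigroup (Ta a)) ->
  forall L : set 'rV[R]_d, L `<=` @orthant R d ->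
  sup_on L (fun t => opnorm (Ta a t \- T t)) @[a --> net_tails le] --> 0%E ->
  forall x, sup_on L (fun t => (rnorm (Ta a t x - T t x))%:E)
    @[a --> net_tails le] --> 0%E.
Proof.
move=> hTa L Lo /(sup_on_cvg0P hle) h x; apply/(sup_on_cvg0P hle) => e e0.
have FF := net_tails_proper hle.
have c0 : 0 < rnorm x + 1 by rewrite ltr_wpDl // rnorm_ge0.
have ec : 0 < e / (rnorm x + 1) by rewrite divr_gt0.
apply: filterS (h _ ec) => a ha t Lt; rewrite lee_fin.
have ci0 : 0 <= (rnorm x + 1)^-1 by rewrite invr_ge0 ltW.
pose y := ((rnorm x + 1)^-1)%:C%C *: x.
have rZ z : rnorm (((rnorm x + 1)^-1)%:C%C *: z) = (rnorm x + 1)^-1 * rnorm z.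
  by rewrite rnormZ ger0_norm ?ler0c.
have y1 : rnorm y <= 1.
  by rewrite rZ mulrC ler_pdivrMr // mul1r lerDl.
have : ((rnorm (Ta a t y - T t y))%:E <= (e / (rnorm x + 1))%:E)%E.
  by apply: le_trans (ha t Lt); apply: ereal_sup_ubound; exists y.
rewrite lee_fin /y (linZ (C0_linear (hTa a) (Lo _ Lt))).
rewrite (linZ (C0_linear hT (Lo _ Lt))) -scalerBr rZ mulrC.
by rewrite ler_pM2r ?invr_gt0.
Qed.
End limits_of_dilations.

Theorem theorem1p1 (R : realType) (d : nat) (hd : (0 < d)%N)
    (H : hilbertType R) (T : 'rV[R]_d -> H -> H)
    (hT : C0_semigroup T) (hA : has_bounded_generators T) :
  [<-> has_regular_unitary_dilation T ;
       completely_dissipative T ;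
       exists (I : Type) (le : I -> I -> Prop) (Ta : I -> 'rV[R]_d -> H -> H),
         [/\ directed le,
             forall a, C0_semigroup (Ta a) /\
                       has_regular_unitary_dilation (Ta a) &
             forall L : set 'rV[R]_d, compact L -> L `<=` @orthant R d ->
               sup_on L (fun t => opnorm (Ta a t \- T t))
                 @[a --> net_tails le] --> 0%E] ;
       exists (I : Type) (le : I -> I -> Prop) (Ta : I -> 'rV[R]_d -> H -> H),
         [/\ directed le,
             forall a, C0_semigroup (Ta a) /\
                       has_regular_unitary_dilation (Ta a) &
             forall (x : H) (L : set 'rV[R]_d), compact L ->
               L `<=` @orthant R d ->
               sup_on L (fun t => (rnorm (Ta a t x - T t x))%:E)
                 @[a --> net_tails le] --> 0%E] ].
Proof.
tfae.
- exact: dilation_completely_dissipative.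
- move=> cd; have pd := completely_dissipative_positive_definite hT hA cd.
  have le_true : directed (fun _ _ : unit => True).
    by split=> // a b; exists tt.
  exists unit, (fun _ _ => True), (fun=> T); split=> // [a|L _ _].
    by split=> //; exact: positive_definite_dilation.
  have FF := net_tails_proper le_true.
  apply/(sup_on_cvg0P le_true) => e e0; apply: nearW => a t _.
  apply: ge_ereal_sup => _ [x _ <-].
  by rewrite /= subrr /rnorm normr0 lee_fin ltW.
- move=> [I [le [Ta [hle hTa lim]]]]; exists I, le, Ta; split=> // x L cL Lo.
  apply: cvg_strong_of_norm => // [a|]; first by case: (hTa a).
  exact: lim.
move=> [I [le [Ta [hle hTa lim]]]].
apply: positive_definite_dilation => //.
apply: (cvg_positive_definite hle (Ta := Ta)) => [a|t x ot].
  by have [h1 h2] := hTa a; exact: dilation_positive_definite.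
have FF := net_tails_proper hle.
have t1 : [set t] `<=` @orthant R d by move=> _ ->.
have := lim x [set t] (@compact_set1 _ t) t1.
move=> /(sup_on_cvg0P hle) h.
apply/cvg_dist0/cvgrPdist_le => e e0; apply: filterS (h e e0) => a /(_ t erefl).
by rewrite lee_fin sub0r normrN ger0_norm ?rnorm_ge0.
Qed.
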